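(* Let $m,n\in\mathbb{Z}$ and $\sigma,\sigma'\in(0,\infty)$. Then \[ \int_0^\pi Q_{m-1/2}(\chi)\cos(n\psi)\,d\psi=\pi(-1)^m\sqrt{\sinh\sigma\sinh\sigma'}\,\frac{\Gamma\left(n-m+\frac12\right)}{\Gamma\left(n+m+\frac12\right)}\,P^m_{n-1/2}(\cosh\sigma_<)\,Q^m_{n-1/2}(\cosh\sigma_>), \] where $\chi=\coth\sigma\coth\sigma'-\operatorname{csch}\sigma\operatorname{csch}\sigma'\cos\psi$ and $\sigma_<=\min\{\sigma,\sigma'\}$, $\sigma_>=\max\{\sigma,\sigma'\}$.
   Context: For $z\in\mathbb{C}\setminus(-\infty,1]$ (principal branches, $\mathbf{F}={}_2F_1/\Gamma(c)$ regularized hypergeometric function): the associated Legendre functions are $P^\mu_\nu(z)=\left(\frac{z+1}{z-1}\right)^{\mu/2}\mathbf{F}\!\left(\nu+1,-\nu;1-\mu;\frac{1-z}{2}\right)$ and $Q^\mu_\nu(z)=e^{\mu\pi i}\frac{\sqrt{\pi}\,\Gamma(\nu+\mu+1)(z^2-1)^{\mu/2}}{2^{\nu+1}z^{\nu+\mu+1}}\,\mathbf{F}\!\left(\frac{\nu+\mu}{2}+1,\frac{\nu+\mu+1}{2};\nu+\frac32;\frac{1}{z^2}\right)$, and $Q_\nu=Q^0_\nu$. *)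

(* Defs.v *)
From Stdlib Require Import Reals Lra.
From Coquelicot Require Import Coquelicot.
Open Scope R_scope.

Definition Gamma_pos (x : R) : R :=
  RInt_gen (fun t => Rpower t (x - 1) * exp (- t)) (at_right 0) (Rbar_locally p_infty).

Fixpoint poch (x : R) (k : nat) : R :=
  match k with O => 1 | S k' => poch x k' * (x + INR k') end.

(* Shift needed so that x + shift x > 0. *)
Definition gshift (x : R) : nat := S (Z.to_nat (- Int_part x)).

(* Gamma function away from its poles (via Gamma(x) = Gamma(x+k)/(x)_k). *)
Definition Gamma (x : R) : R := Gamma_pos (x + INR (gshift x)) / poch x (gshift x).

(* Reciprocal Gamma 1/Gamma(x), entire: equals 0 at x = 0,-1,-2,... *)
Definition rGamma (x : R) : R := poch x (gshift x) / Gamma_pos (x + INR (gshift x)).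

Definition hyp2F1r_series (a b c x : R) : R :=
  Series (fun k => poch a k * poch b k * rGamma (c + INR k) / INR (Factorial.fact k) * x ^ k).

(* Principal branch of the regularized hypergeometric function on (-oo,1):
   the power series on (-1,1), and its analytic continuation to (-oo,-1]
   given by Pfaff's transformation F(a,b;c;x) = (1-x)^(-a) F(a,c-b;c;x/(x-1)). *)
Definition hyp2F1r (a b c x : R) : R :=
  if Rlt_dec (Rabs x) 1 then hyp2F1r_series a b c x
  else Rpower (1 - x) (- a) * hyp2F1r_series a (c - b) c (x / (x - 1)).

Definition LegendreP (m : Z) (nu z : R) : R :=
  Rpower ((z + 1) / (z - 1)) (IZR m / 2) * hyp2F1r (nu + 1) (- nu) (1 - IZR m) ((1 - z) / 2).

(* Associated Legendre function of the second kind Q^mu_nu(z), z > 1, integer order mu = m;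
   the factor e^{mu pi i} equals (-1)^m. *)
Definition LegendreQ (m : Z) (nu z : R) : R :=
  powerRZ (-1) m * sqrt PI * Gamma (nu + IZR m + 1) * Rpower (z ^ 2 - 1) (IZR m / 2)
  / (Rpower 2 (nu + 1) * Rpower z (nu + IZR m + 1))
  * hyp2F1r ((nu + IZR m) / 2 + 1) ((nu + IZR m + 1) / 2) (nu + 3 / 2) (1 / z ^ 2).

Definition coth (x : R) : R := cosh x / sinh x.
Definition csch (x : R) : R := 1 / sinh x.

(* Main.v *)
Require Import Defs.
From Stdlib Require Import Reals Factorial ZArith Lra Lia.
From Coquelicot Require Import Coquelicot.
Open Scope R_scope.

(** Let M = |m|, N = |n|, al = M + 1/2, z = cosh s_<, c = cosh s_>.  Up to a constant
    factor the integrand is (sinh s sinh s')^al H(z, psi) cos(n psi), where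
    H = D^(-al) F((al+1)/2, al/2; al+1/2; (c^2-1)(z^2-1)/D^2) and D = c z - cos psi.
    The kernel H satisfies
      (z^2-1) H_zz + (2 al + 1) z H_z + al^2 H + H_psipsi = 0,
    so its cosine coefficient h(z) solves the Gegenbauer equation
      (z^2-1) h'' + (2 al + 1) z h' + (al^2 - n^2) h = 0
    on 1 <= z < c and is regular at z = 1.  A Wronskian argument identifies h with a
    multiple of the regular solution, which is P^m_(n-1/2)(z) / (z^2-1)^(M/2) up to a
    factor.  The multiple is h(1), the integral of (c - cos psi)^(-al) cos(n psi); the
    binomial series expands it into Q^m_(n-1/2)(c).  The signs of m and n are removed by
    the zeros of 1/Gamma and by Euler's and Pfaff's transformations, which follow from the
    same uniqueness argument.  For s = s' one lets z tend to c: the kernel is dominated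
    by K psi^(-1/2) uniformly in z. *)

(** * Pochhammer symbols *)

(** When s = s' the integrand has a logarithmic singularity at psi = 0, which is why the integral is
    taken as a limit at 0. For z < c the kernel is smooth up to psi = 0 and can be differentiated
    under the integral; z = c is out of reach of that argument. Comparing differential equations
    instead of coefficients makes one argument serve everywhere. P^m passes from its power series to
    Pfaff's continuation at z = 3, and the two signs of m give different series, yet each is a
    solution regular at z = 1 and hence a multiple of the single reference solution [geg_pfaff].
    This form is the reference because for z >= 1 its series argument (z-1)/(z+1) stays in [0,1) and
    for n >= 0 its parameters are positive: it has no zeros and may be divided by. Gamma occurs only
    at integers and half-integers. The value at 1/2 enters both sides once and cancels, so that the
    recurrence and non-vanishing suffice there. *)

Lemma poch_S x k : poch x (S k) = poch x k * (x + INR k).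
Proof. reflexivity. Qed.

Lemma poch_S_l x k : poch x (S k) = x * poch (x + 1) k.
Proof.
  induction k as [|k IH]; [simpl; ring|].
  rewrite poch_S, IH, poch_S, S_INR. ring.
Qed.

Lemma poch_add x j k : poch x (j + k) = poch x j * poch (x + INR j) k.
Proof.
  induction k as [|k IH].
  - rewrite Nat.add_0_r; simpl; ring.
  - rewrite Nat.add_succ_r; rewrite !poch_S, IH, plus_INR. ring.
Qed.

(** Legendre's duplication formula in finite form. It creates the half-step parameters of Q out of
    ordinary Pochhammer symbols, both in the binomial expansion and in the symmetry of Q in its
    degree. *)
Lemma poch_duplication b k :
  poch (2 * b) (2 * k) = 4 ^ k * poch b k * poch (b + 1 / 2) k.
Proof.
  induction k as [|k IH]; [simpl; ring|].
  replace (2 * S k)%nat with (S (S (2 * k))) by lia.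
  rewrite !poch_S, IH, S_INR, mult_INR. simpl. field.
Qed.

Lemma poch_reflection x k : poch x k = (-1) ^ k * poch (1 - x - INR k) k.
Proof.
  revert x; induction k as [|k IH]; intros x; [simpl; ring|].
  rewrite (poch_S_l (1 - x - INR (S k))). rewrite !poch_S, IH, S_INR.
  replace (1 - x - (INR k + 1) + 1) with (1 - x - INR k) by ring.
  simpl pow. ring.
Qed.

Lemma poch_pos x k : 0 < x -> 0 < poch x k.
Proof.
  intros Hx; induction k as [|k IH]; simpl; [lra|].
  apply Rmult_lt_0_compat; [easy|]. pose proof (pos_INR k); lra.
Qed.

Lemma poch_INR n k : poch (INR n + 1) k * INR (fact n) = INR (fact (n + k)).
Proof.
  induction k as [|k IH]; [rewrite Nat.add_0_r; simpl; ring|].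
  rewrite Nat.add_succ_r, fact_simpl, mult_INR, <- IH, S_INR, plus_INR.
  rewrite poch_S; ring.
Qed.

Lemma IZR_plus_half_neq_0 j : IZR j + 1 / 2 <> 0.
Proof.
  intros H. assert (H1 : IZR (2 * j + 1) = 0)
    by (rewrite plus_IZR, mult_IZR; lra).
  apply eq_IZR_R0 in H1; lia.
Qed.

Lemma poch_half_neq_0 j k : poch (IZR j + 1 / 2) k <> 0.
Proof.
  induction k as [|k IH]; simpl; [lra|].
  apply Rmult_integral_contrapositive_currified; [easy|].
  rewrite INR_IZR_INZ. replace (IZR j + 1 / 2 + IZR (Z.of_nat k))
    with (IZR (j + Z.of_nat k) + 1 / 2) by (rewrite plus_IZR; ring).
  apply IZR_plus_half_neq_0.
Qed.

(** * The Gamma function at integers and half-integers *)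

Lemma is_RInt_gen_antiderivative (f F : R -> R) (la lb : R) :
  (forall t, 0 < t -> is_derive F t (f t)) ->
  (forall t, 0 < t -> continuous f t) ->
  filterlim F (at_right 0) (locally la) ->
  filterlim F (Rbar_locally p_infty) (locally lb) ->
  is_RInt_gen f (at_right 0) (Rbar_locally p_infty) (lb - la).
Proof.
  intros HF Hf Ha Hb P HP.
  assert (Hlim : filterlim (fun ab : R * R => F (snd ab) - F (fst ab))
    (filter_prod (at_right 0) (Rbar_locally p_infty)) (locally (lb - la))).
  { apply (filterlim_comp_2 (F := filter_prod (at_right 0) (Rbar_locally p_infty))
      (fun ab : R * R => F (snd ab)) (fun ab : R * R => - F (fst ab)) Rplus
      (G := locally lb) (H := locally (- la))).
    - apply filterlim_comp with (2 := Hb), filterlim_snd.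
    - apply filterlim_comp with (G := locally la).
      + apply filterlim_comp with (2 := Ha), filterlim_fst.
      + apply (filterlim_opp la).
    - apply (filterlim_plus lb (- la)). }
  assert (Hpos : filter_prod (at_right 0) (Rbar_locally p_infty)
      (fun ab : R * R => 0 < fst ab /\ 0 < snd ab)).
  { apply (Filter_prod _ _ _ (fun x => 0 < x) (fun x => 0 < x)).
    - exists (mkposreal 1 Rlt_0_1); intros y _ Hy; exact Hy.
    - exists 0; intros x Hx; exact Hx.
    - intros x y Hx Hy; split; assumption. }
  specialize (Hlim P HP). unfold filtermap in Hlim. unfold filtermapi.
  generalize (filter_and _ _ Hlim Hpos).
  apply filter_imp; intros [a b] [HPab [Ha0 Hb0]]; simpl in *.
  exists (F b - F a); split; [|exact HPab].
  assert (Hm : 0 < Rmin a b) by (apply Rmin_glb_lt; assumption).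
  apply (is_RInt_derive F f a b); intros x Hx.
  - apply HF; lra.
  - apply Hf; lra.
Qed.

Definition is_Gamma (y l : R) : Prop :=
  is_RInt_gen (fun t => Rpower t (y - 1) * exp (- t))
    (at_right 0) (Rbar_locally p_infty) l.

Lemma is_Gamma_unique y l : is_Gamma y l -> Gamma_pos y = l.
Proof. intros H; unfold Gamma_pos; apply is_RInt_gen_unique, H. Qed.

Lemma is_derive_Rpower t y : 0 < t ->
  is_derive (fun t => Rpower t y) t (y * Rpower t (y - 1)).
Proof.
  intros Ht. apply is_derive_Reals. now apply derivable_pt_lim_power.
Qed.

Lemma continuous_Rpower t y : 0 < t -> continuous (fun t => Rpower t y) t.
Proof.
  intros Ht. apply (ex_derive_continuous (fun t => Rpower t y)).
  eexists; now apply is_derive_Rpower.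
Qed.

Lemma continuous_Gamma_integrand t y : 0 < t ->
  continuous (fun t => Rpower t y * exp (- t)) t.
Proof.
  intros Ht. apply (continuous_mult (fun t => Rpower t y) (fun t => exp (- t))).
  - now apply continuous_Rpower.
  - apply (ex_derive_continuous (fun t => exp (- t))). auto_derive; auto.
Qed.

Lemma filterlim_exp_opp_p_infty (k : R) :
  filterlim (fun t => exp (k - t / 2)) (Rbar_locally p_infty) (locally 0).
Proof.
  apply (filterlim_comp _ _ _ (fun t => k - t / 2) exp _ (Rbar_locally m_infty)).
  - intros P [N HN]. exists (2 * (k - N)). intros x Hx. apply HN. lra.
  - apply (is_lim_exp_m).
Qed.

Lemma Rpower_exp_opp_p_infty (y : R) : 0 < y ->
  filterlim (fun t => Rpower t y * exp (- t)) (Rbar_locally p_infty) (locally 0).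
Proof.
  intros Hy.
  apply (filterlim_le_le (fun _ => 0) (fun t => Rpower t y * exp (- t))
          (fun t => exp (y * ln (2 * y) - t / 2)) 0).
  - exists 1. intros t Ht. split.
    + left; apply Rmult_lt_0_compat; apply exp_pos.
    + unfold Rpower. rewrite <- exp_plus.
      (* This is [ln u <= u] at [u = t / (2 y)]; the scale [2 y] makes the power cost only
         [exp (t / 2)], half of the available decay. *)
      assert (Hl : ln t <= t / (2 * y) + ln (2 * y)).
      { replace t with (t / (2 * y) * (2 * y)) at 1 by (field; lra).
        assert (0 < t / (2 * y)) by (apply Rdiv_lt_0_compat; lra).
        rewrite ln_mult by lra.
        assert (ln (t / (2 * y)) <= t / (2 * y)); [|lra].
        rewrite <- (ln_exp (t / (2 * y))) at 2. left.
        apply ln_increasing; [lra|]. pose proof (exp_ineq1 (t / (2 * y))); lra. }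
      assert (y * ln t <= t / 2 + y * ln (2 * y)).
      { replace (t / 2 + y * ln (2 * y)) with (y * (t / (2 * y) + ln (2 * y)))
          by (field; lra). apply Rmult_le_compat_l; lra. }
      destruct (Rle_lt_or_eq_dec (y * ln t + - t) (y * ln (2 * y) - t / 2)) as [H1|H1];
        [lra| |rewrite H1; lra].
      left; now apply exp_increasing.
  - apply filterlim_const.
  - apply filterlim_exp_opp_p_infty.
Qed.

Lemma Rpower_exp_opp_at_right_0 (y : R) : 1 <= y ->
  filterlim (fun t => Rpower t y * exp (- t)) (at_right 0) (locally 0).
Proof.
  intros Hy.
  apply (filterlim_le_le (fun _ => 0) (fun t => Rpower t y * exp (- t))
          (fun t => t) 0).
  - exists (mkposreal 1 Rlt_0_1). intros t Ht Ht0.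
    assert (Ht1 : t < 1).
    { change (Rabs (t - 0) < 1) in Ht. apply Rabs_def2 in Ht; lra. }
    split; [left; apply Rmult_lt_0_compat; apply exp_pos|].
    assert (Rpower t y <= t).
    { rewrite <- (Rpower_1 t) at 2 by lra. unfold Rpower.
      assert (ln t < 0) by (rewrite <- ln_1; apply ln_increasing; lra).
      destruct (Rle_lt_or_eq_dec (y * ln t) (1 * ln t)) as [H1|H1]; [nra| |rewrite H1; lra].
      left; now apply exp_increasing. }
    assert (exp (- t) < 1) by (rewrite <- exp_0; apply exp_increasing; lra).
    pose proof (exp_pos (- t)). assert (0 < Rpower t y) by apply exp_pos. nra.
  - apply filterlim_const.
  - intros P [e He]. exists e. intros x Hx _. now apply He.
Qed.

Lemma is_Gamma_1 : is_Gamma 1 1.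
Proof.
  cut (is_Gamma 1 (0 - (-1))); [now replace (0 - (-1)) with 1 by ring|].
  apply is_RInt_gen_antiderivative with (fun t => - exp (- t)).
  - intros t Ht. replace (1 - 1) with 0 by ring. rewrite Rpower_O by easy.
    auto_derive; [auto|ring].
  - intros t Ht; now apply continuous_Gamma_integrand.
  - apply (filterlim_filter_le_1 (G := at_right 0) (F := locally 0)).
    { apply filter_le_within. }
    replace (-1) with (- exp (- 0)) by (rewrite Ropp_0, exp_0; ring).
    apply (ex_derive_continuous (fun t => - exp (- t))); auto_derive; auto.
  - replace 0 with (- 0) by ring.
    apply filterlim_comp with (G := locally 0); [|apply (filterlim_opp 0)].
    apply filterlim_comp with (G := Rbar_locally m_infty); [|apply is_lim_exp_m].
    intros P [N HN]; exists (- N); intros x Hx; apply HN; lra.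
Qed.

(** Integration by parts with antiderivative [- t^y exp (- t)]. For [1 <= y] the boundary term at 0
    is squeezed by [t]; the starting points 1 and 3/2 both satisfy this. *)
Lemma is_Gamma_succ y l : 1 <= y -> is_Gamma y l -> is_Gamma (y + 1) (y * l).
Proof.
  intros Hy Hl. unfold is_Gamma in *.
  assert (H : is_RInt_gen (fun t => Rpower t y * exp (- t)
      - y * (Rpower t (y - 1) * exp (- t)))
      (at_right 0) (Rbar_locally p_infty) (- 0 - - 0)).
  { apply is_RInt_gen_antiderivative with (fun t => - (Rpower t y * exp (- t))).
    - intros t Ht.
      assert (Hd := is_derive_Rpower t y Ht).
      apply (is_derive_ext (fun t => - Rpower t y * exp (- t)));
        [intros u; change (- Rpower u y * exp (- u) = - (Rpower u y * exp (- u))); ring|].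
      evar_last.
      + apply (is_derive_mult (fun t => - Rpower t y) (fun t => exp (- t))).
        * apply (is_derive_opp (fun t => Rpower t y)), Hd.
        * auto_derive; [auto|reflexivity].
        * intros; apply Rmult_comm.
      + unfold plus, mult, opp; simpl. ring.
    - intros t Ht. apply (continuous_minus (fun t => Rpower t y * exp (- t))).
      + now apply continuous_Gamma_integrand.
      + apply (continuous_scal_r y (fun t => Rpower t (y - 1) * exp (- t))).
        now apply continuous_Gamma_integrand.
    - apply filterlim_comp with (2 := filterlim_opp 0).
      now apply Rpower_exp_opp_at_right_0.
    - apply filterlim_comp with (2 := filterlim_opp 0).
      apply Rpower_exp_opp_p_infty; lra. }
  assert (H2 := is_RInt_gen_plus _ _ _ _ H (is_RInt_gen_scal _ y _ Hl)).
  eapply is_RInt_gen_ext in H2.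
  - replace (y * l) with (plus (- 0 - - 0) (scal y l)); [exact H2|].
    unfold plus, scal; simpl; unfold mult; simpl; ring.
  - apply filter_forall. intros ab x _. unfold plus, scal; simpl; unfold mult; simpl.
    replace (y + 1 - 1) with y by ring. ring.
Qed.

Lemma filterlim_p_infty_bounded_incr (F : R -> R) (B : R) :
  (forall x y, 0 <= x -> x <= y -> F x <= F y) ->
  (forall x, 0 <= x -> F x <= B) ->
  exists l, (forall x, 0 <= x -> F x <= l) /\
    filterlim F (Rbar_locally p_infty) (locally l).
Proof.
  intros Hinc HB.
  destruct (completeness (fun v => exists x, 0 <= x /\ v = F x)) as [l [Hub Hlub]].
  - exists B. intros v [x [Hx ->]]. now apply HB.
  - exists (F 0), 0. split; [lra|easy].
  - assert (Hl : forall x, 0 <= x -> F x <= l).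
    { intros x Hx. apply Hub. now exists x. }
    exists l; split; [exact Hl|].
    intros P [e He].
    destruct (Classical_Prop.classic (exists x, 0 <= x /\ l - e < F x))
      as [[x0 [Hx0 Hlt]]|Hno].
    + exists x0. intros x Hx. apply He.
      assert (F x0 <= F x) by (apply Hinc; lra).
      assert (F x <= l) by (apply Hl; lra).
      change (Rabs (F x - l) < e). rewrite Rabs_left1; lra.
    + exfalso. assert (l <= l - e).
      { apply Hlub. intros v [x [Hx ->]].
        destruct (Rle_lt_dec (F x) (l - e)); [easy|].
        exfalso; apply Hno; now exists x. }
      pose proof (cond_pos e); lra.
Qed.

(** The start is 3/2 rather than 1/2 because [sqrt t * exp (- t)] is continuous on the whole line,
    so the lower limit 0 is harmless. The shift in [Gamma] always lands on some [3/2 + k] when the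
    argument is a half-integer. *)
Lemma is_Gamma_3_2 : exists l, 0 < l /\ is_Gamma (3 / 2) l.
Proof.
  pose (f := fun t => sqrt t * exp (- t)).
  assert (Hf : forall t, continuous f t).
  { intros t. apply (continuous_mult sqrt (fun t => exp (- t))).
    - apply continuous_sqrt.
    - apply (ex_derive_continuous (fun t => exp (- t))). auto_derive; auto. }
  assert (Hex : forall a b, ex_RInt f a b).
  { intros a b. apply (ex_RInt_continuous f). intros z _; apply Hf. }
  assert (Hpos : forall t, 0 <= f t).
  { intros t; apply Rmult_le_pos; [apply sqrt_pos|left; apply exp_pos]. }
  destruct (filterlim_p_infty_bounded_incr (fun x => RInt f 0 x) 2) as [l [Hle Hlim]].
  - intros x y Hx Hxy. rewrite <- (RInt_Chasles f 0 x y) by apply Hex.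
    unfold plus; simpl.
    assert (0 <= RInt f x y); [|lra].
    apply RInt_ge_0; [easy|apply Hex|intros; apply Hpos].
  - intros x Hx.
    (* The majorant comes from [sqrt t <= 1 + t]. Its antiderivative [- (2 + t) exp (- t)] rises
       from -2 towards 0, hence the bound 2. *)
    assert (HI : is_RInt (fun t => (1 + t) * exp (- t)) 0 x
        (minus (- (2 + x) * exp (- x)) (- (2 + 0) * exp (- 0)))).
    { apply (is_RInt_derive (fun t => - (2 + t) * exp (- t))).
      - intros t _. auto_derive; [auto|ring].
      - intros t _. apply (ex_derive_continuous (fun t => (1 + t) * exp (- t))).
        auto_derive; auto. }
    apply Rle_trans with (RInt (fun t => (1 + t) * exp (- t)) 0 x).
    + apply RInt_le; [easy|apply Hex|eexists; apply HI|].
      intros t Ht. apply Rmult_le_compat_r; [left; apply exp_pos|].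
      destruct (Rle_lt_dec t 1).
      * assert (sqrt t <= sqrt 1) by (apply sqrt_le_1; lra).
        rewrite sqrt_1 in H. lra.
      * pose proof (sqrt_less t). lra.
    + rewrite (is_RInt_unique _ _ _ _ HI). unfold minus, plus, opp; simpl.
      rewrite Ropp_0, exp_0. pose proof (exp_pos (- x)). nra.
  - exists l; split.
    + apply Rlt_le_trans with (RInt f 0 1); [|apply Hle; lra].
      apply RInt_gt_0; [lra| |intros; apply Hf].
      intros x Hx. apply Rmult_lt_0_compat; [apply sqrt_lt_R0; lra|apply exp_pos].
    + unfold is_Gamma. replace l with (l - 0) by ring.
      apply is_RInt_gen_antiderivative with (fun x => RInt f 0 x).
      * intros t Ht. replace (3 / 2 - 1) with (/ 2) by field.
        rewrite Rpower_sqrt by easy.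
        apply (is_derive_RInt f (fun x => RInt f 0 x) 0 t).
        -- apply filter_forall; intros x. apply (RInt_correct f), Hex.
        -- apply Hf.
      * intros t Ht; now apply continuous_Gamma_integrand.
      * apply (filterlim_filter_le_1 (G := at_right 0) (F := locally 0));
          [apply filter_le_within|].
        replace 0 with (RInt f 0 0) at 2 by exact (RInt_point 0 f).
        apply (ex_derive_continuous (fun x => RInt f 0 x)).
        exists (f 0). apply (is_derive_RInt f (fun x => RInt f 0 x) 0 0).
        -- apply filter_forall; intros x. apply (RInt_correct f), Hex.
        -- apply Hf.
      * exact Hlim.
Qed.

Lemma is_Gamma_INR k : is_Gamma (INR k + 1) (INR (fact k)).
Proof.
  induction k as [|k IH].
  - simpl. rewrite Rplus_0_l. apply is_Gamma_1.
  - rewrite fact_simpl, mult_INR, S_INR. apply is_Gamma_succ; [|exact IH].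
    pose proof (pos_INR k); lra.
Qed.

Lemma is_Gamma_3_2_plus l k : is_Gamma (3 / 2) l ->
  is_Gamma (3 / 2 + INR k) (poch (3 / 2) k * l).
Proof.
  intros Hl; induction k as [|k IH].
  - simpl. rewrite Rplus_0_r, Rmult_1_l. exact Hl.
  - rewrite S_INR. rewrite poch_S.
    replace (3 / 2 + (INR k + 1)) with (3 / 2 + INR k + 1) by ring.
    replace (poch (3 / 2) k * (3 / 2 + INR k) * l)
      with ((3 / 2 + INR k) * (poch (3 / 2) k * l)) by ring.
    apply is_Gamma_succ; [|exact IH]. pose proof (pos_INR k); lra.
Qed.

Lemma gshift_pos x : 0 <= x -> gshift x = 1%nat.
Proof.
  intros Hx. unfold gshift. f_equal.
  destruct (base_Int_part x) as [_ H].
  assert (- 1 < Int_part x)%Z by (apply lt_IZR; lra). lia.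
Qed.

Lemma rGamma_INR_succ k : rGamma (INR k + 1) = / INR (fact k).
Proof.
  unfold rGamma. pose proof (pos_INR k).
  rewrite gshift_pos by lra. rewrite <- S_INR at 2. simpl (INR 1).
  rewrite (is_Gamma_unique _ _ (is_Gamma_INR (S k))).
  rewrite fact_simpl, mult_INR, S_INR. simpl. field.
  split; [apply INR_fact_neq_0|lra].
Qed.

(** The shift at [- k] is exactly [k + 1], so the last Pochhammer factor is the zero [- k + k]. *)
Lemma rGamma_opp_INR k : rGamma (- INR k) = 0.
Proof.
  unfold rGamma.
  assert (gshift (- INR k) = S k) as ->.
  { unfold gshift. f_equal. rewrite INR_IZR_INZ, <- opp_IZR.
    rewrite <- (Int_part_spec _ (- Z.of_nat k)); [lia|].
    lra. }
  rewrite poch_S. replace (- INR k + INR k) with 0 by ring. unfold Rdiv; ring.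
Qed.

Lemma gshift_half j : gshift (IZR j + 1 / 2) = S (Z.to_nat (- j)).
Proof.
  unfold gshift. rewrite <- (Int_part_spec (IZR j + 1 / 2) j); [easy|lra].
Qed.

(** For [j >= 0] the shift is 1 and the recurrence is that of the integral; for [j < 0] the shifts
    at [j] and [j + 1] both lead to 3/2 and the recurrence is that of the Pochhammer symbols. *)
Lemma Gamma_half_succ j :
  Gamma (IZR j + 1 / 2 + 1) = (IZR j + 1 / 2) * Gamma (IZR j + 1 / 2) /\
  Gamma (IZR j + 1 / 2) <> 0.
Proof.
  destruct is_Gamma_3_2 as [l [Hl0 Hl]].
  unfold Gamma.
  replace (IZR j + 1 / 2 + 1) with (IZR (j + 1) + 1 / 2) by (rewrite plus_IZR; ring).
  rewrite !gshift_half.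
  pose proof (IZR_plus_half_neq_0 j) as Hj.
  destruct (Z_le_dec 0 j) as [H|H].
  - destruct (Z_of_nat_complete j H) as [k ->].
    replace (Z.to_nat (- Z.of_nat k)) with 0%nat by lia.
    replace (Z.to_nat (- (Z.of_nat k + 1))) with 0%nat by lia.
    rewrite plus_IZR, <- INR_IZR_INZ in *. simpl.
    replace (INR k + 1 + 1 / 2 + 1) with (3 / 2 + INR (S k))
      by (rewrite S_INR; field).
    replace (INR k + 1 / 2 + 1) with (3 / 2 + INR k) by field.
    rewrite !(is_Gamma_unique _ _ (is_Gamma_3_2_plus l _ Hl)).
    rewrite poch_S. pose proof (pos_INR k).
    split; [field; lra|].
    apply Rmult_integral_contrapositive_currified.
    + apply Rmult_integral_contrapositive_currified; [|lra].
      apply Rgt_not_eq, poch_pos; lra.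
    + apply Rinv_neq_0_compat; lra.
  - replace (Z.to_nat (- j)) with (S (Z.to_nat (- (j + 1)))) by lia.
    set (k := Z.to_nat (- (j + 1))).
    assert (Hk : IZR j = - INR k - 1).
    { unfold k. rewrite INR_IZR_INZ, Z2Nat.id, opp_IZR, plus_IZR by lia. ring. }
    rewrite plus_IZR. rewrite !S_INR.
    replace (IZR j + 1 + 1 / 2 + (INR k + 1)) with (3 / 2) by (rewrite Hk; field).
    replace (IZR j + 1 / 2 + (INR k + 1 + 1)) with (3 / 2) by (rewrite Hk; field).
    rewrite (is_Gamma_unique _ _ Hl).
    rewrite (poch_S_l (IZR j + 1 / 2)).
    replace (IZR j + 1 / 2 + 1) with (IZR j + 1 + 1 / 2) by ring.
    assert (Hp : poch (IZR j + 1 + 1 / 2) (S k) <> 0).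
    { rewrite <- plus_IZR. apply poch_half_neq_0. }
    set (x := IZR j + 1 / 2) in *. set (p := poch _ _) in *.
    split; [field; split; easy|].
    apply Rmult_integral_contrapositive_currified; [lra|].
    apply Rinv_neq_0_compat, Rmult_integral_contrapositive_currified; easy.
Qed.

Lemma Gamma_half_neq_0 j : Gamma (IZR j + 1 / 2) <> 0.
Proof. apply Gamma_half_succ. Qed.

Lemma Gamma_half_poch j k :
  Gamma (IZR j + 1 / 2 + INR k) = poch (IZR j + 1 / 2) k * Gamma (IZR j + 1 / 2).
Proof.
  induction k as [|k IH]; [simpl; rewrite Rplus_0_r; ring|].
  rewrite S_INR. rewrite poch_S.
  replace (IZR j + 1 / 2 + (INR k + 1)) with (IZR (j + Z.of_nat k) + 1 / 2 + 1)
    by (rewrite plus_IZR, INR_IZR_INZ; ring).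
  rewrite (proj1 (Gamma_half_succ _)).
  replace (IZR (j + Z.of_nat k) + 1 / 2) with (IZR j + 1 / 2 + INR k)
    by (rewrite plus_IZR, INR_IZR_INZ; ring).
  rewrite IH. ring.
Qed.

(** * Hypergeometric series with a positive integer third parameter *)

Lemma eventually_decr_bounded (v : nat -> R) k0 :
  (forall k, (k0 <= k)%nat -> v (S k) <= v k) -> exists B, forall k, v k <= B.
Proof.
  revert v; induction k0 as [|k0 IH]; intros v Hv.
  - exists (v 0%nat). induction k as [|k IHk]; [lra|].
    apply Rle_trans with (2 := IHk), Hv; lia.
  - destruct (IH (fun k => v (S k))) as [B HB].
    + intros k Hk; apply Hv; lia.
    + exists (Rmax (v 0%nat) B). intros [|k]; [apply Rmax_l|].
      apply Rle_trans with (1 := HB k), Rmax_r.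
Qed.

(** A ratio inequality without division also covers series that terminate, where the usual ratio
    test asks for non-zero terms. *)
Lemma CV_radius_gt_of_ratio (u : nat -> R) (K x : R) :
  (forall k, Rabs (u (S k)) <= (1 + K / (INR k + 1)) * Rabs (u k)) ->
  Rabs x < 1 -> Rbar_lt (Rabs x) (CV_radius u).
Proof.
  intros Hu Hx.
  set (r := (Rabs x + 1) / 2).
  pose proof (Rabs_pos x) as Hx0.
  assert (Hr : Rabs x < r < 1) by (unfold r; lra).
  apply Rbar_lt_le_trans with (Finite r); [simpl; lra|].
  apply (CV_radius_bounded u).
  (* From this index on [(1 + K / (k + 1)) * r <= 1], so [|u k * r^k|] no longer increases. *)
  destruct (nfloor_ex (Rabs K * r / (1 - r))) as [k0 Hk0].
  { apply Rdiv_le_0_compat; [|lra]. apply Rmult_le_pos; [apply Rabs_pos|lra]. }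
  apply (eventually_decr_bounded (fun n => Rabs (u n * r ^ n)) k0).
  intros k Hk. simpl pow.
  rewrite !Rabs_mult. rewrite (Rabs_pos_eq r) by lra.
  replace (Rabs (u (S k)) * (r * Rabs (r ^ k)))
    with (Rabs (u (S k)) * r * Rabs (r ^ k)) by ring.
  apply Rmult_le_compat_r; [apply Rabs_pos|].
  apply le_INR in Hk. pose proof (pos_INR k0).
  assert (HK : K / (INR k + 1) * r <= 1 - r).
  { apply Rmult_le_reg_r with (INR k + 1); [lra|].
    replace (K / (INR k + 1) * r * (INR k + 1)) with (K * r) by (field; lra).
    apply Rle_trans with (Rabs K * r);
      [apply Rmult_le_compat_r; [lra|apply Rle_abs]|].
    replace (Rabs K * r) with (Rabs K * r / (1 - r) * (1 - r)) by (field; lra).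
    rewrite Rmult_comm. apply Rmult_le_compat_l; lra. }
  apply Rle_trans with ((1 + K / (INR k + 1)) * Rabs (u k) * r).
  - apply Rmult_le_compat_r; [lra|apply Hu].
  - replace ((1 + K / (INR k + 1)) * Rabs (u k) * r)
      with ((r + K / (INR k + 1) * r) * Rabs (u k)) by ring.
    rewrite <- (Rmult_1_l (Rabs (u k))) at 2.
    apply Rmult_le_compat_r; [apply Rabs_pos|lra].
Qed.

(** Coefficients of the regularized F(a,b;M+1;x): the factorial of [M + k] is Gamma(M+1+k). Below,
    [hs] is the function and [hs1], [hs2] are its termwise derivatives. *)
Definition hcoef (a b : R) (M k : nat) : R :=
  poch a k * poch b k / (INR (fact (M + k)) * INR (fact k)).

Definition hs (a b : R) (M : nat) (x : R) : R := PSeries (hcoef a b M) x.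

Definition hs1 (a b : R) (M : nat) (x : R) : R := PSeries (PS_derive (hcoef a b M)) x.

Definition hs2 (a b : R) (M : nat) (x : R) : R :=
  PSeries (PS_derive (PS_derive (hcoef a b M))) x.

Lemma hcoef_sym a b M k : hcoef a b M k = hcoef b a M k.
Proof. unfold hcoef. f_equal; ring. Qed.

Lemma hs_sym a b M x : hs a b M x = hs b a M x.
Proof. apply PSeries_ext; intros k; apply hcoef_sym. Qed.

Lemma hcoef_succ a b M k :
  (INR k + 1) * (INR M + 1 + INR k) * hcoef a b M (S k) =
  (a + INR k) * (b + INR k) * hcoef a b M k.
Proof.
  unfold hcoef. rewrite Nat.add_succ_r, !fact_simpl, !mult_INR, !poch_S, !S_INR, plus_INR.
  pose proof (pos_INR k). pose proof (pos_INR M).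
  field. repeat split; try apply INR_fact_neq_0; lra.
Qed.

Lemma hcoef_radius a b M x : Rabs x < 1 -> Rbar_lt (Rabs x) (CV_radius (hcoef a b M)).
Proof.
  intros Hx. set (A := Rabs a + Rabs b).
  apply CV_radius_gt_of_ratio with (2 * A + A * A); [|exact Hx].
  intros k.
  pose proof (pos_INR k). pose proof (pos_INR M).
  assert (HA : 0 <= A) by (unfold A; pose proof (Rabs_pos a); pose proof (Rabs_pos b); lra).
  assert (Ha : Rabs (a + INR k) <= INR k + 1 + A).
  { eapply Rle_trans; [apply Rabs_triang|]. rewrite (Rabs_pos_eq (INR k)) by lra.
    unfold A; pose proof (Rabs_pos b); lra. }
  assert (Hb : Rabs (b + INR k) <= INR k + 1 + A).
  { eapply Rle_trans; [apply Rabs_triang|]. rewrite (Rabs_pos_eq (INR k)) by lra.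
    unfold A; pose proof (Rabs_pos a); lra. }
  set (t := INR k + 1) in *.
  assert (Hrec : t * (INR M + t) * Rabs (hcoef a b M (S k)) =
      Rabs (a + INR k) * Rabs (b + INR k) * Rabs (hcoef a b M k)).
  { rewrite <- !Rabs_mult, <- hcoef_succ, !Rabs_mult. fold t.
    rewrite (Rabs_pos_eq t), (Rabs_pos_eq (INR M + 1 + INR k)) by (unfold t; lra).
    unfold t; ring. }
  pose proof (Rabs_pos (hcoef a b M (S k))). pose proof (Rabs_pos (hcoef a b M k)).
  pose proof (Rabs_pos (a + INR k)). pose proof (Rabs_pos (b + INR k)).
  assert (Ht : 1 <= t) by (unfold t; lra).
  apply Rmult_le_reg_l with (t * t); [nra|].
  apply Rle_trans with (t * (INR M + t) * Rabs (hcoef a b M (S k))).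
  - apply Rmult_le_compat_r; [easy|nra].
  - rewrite Hrec.
    apply Rle_trans with ((t + A) * (t + A) * Rabs (hcoef a b M k)).
    + apply Rmult_le_compat_r; [easy|]. apply Rmult_le_compat; easy.
    + replace (t * t * ((1 + (2 * A + A * A) / t) * Rabs (hcoef a b M k)))
        with ((t * t + (2 * A + A * A) * t) * Rabs (hcoef a b M k)) by (field; lra).
      apply Rmult_le_compat_r; [easy|]. nra.
Qed.

Lemma is_derive_hs a b M x : Rabs x < 1 -> is_derive (hs a b M) x (hs1 a b M x).
Proof. intros Hx. apply is_derive_PSeries, hcoef_radius, Hx. Qed.

Lemma is_derive_hs1 a b M x : Rabs x < 1 -> is_derive (hs1 a b M) x (hs2 a b M x).
Proof.
  intros Hx. apply is_derive_PSeries. rewrite CV_radius_derive. now apply hcoef_radius.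
Qed.

Lemma continuous_hs a b M x : Rabs x < 1 -> continuous (hs a b M) x.
Proof.
  intros Hx. apply (ex_derive_continuous (hs a b M)). eexists; now apply is_derive_hs.
Qed.

Lemma continuous_hs1 a b M x : Rabs x < 1 -> continuous (hs1 a b M) x.
Proof.
  intros Hx. apply (ex_derive_continuous (hs1 a b M)). eexists; now apply is_derive_hs1.
Qed.

Lemma continuous_hs2 a b M x : Rabs x < 1 -> continuous (hs2 a b M) x.
Proof.
  intros Hx. apply (ex_derive_continuous (hs2 a b M)). eexists.
  apply is_derive_PSeries. rewrite !CV_radius_derive. now apply hcoef_radius.
Qed.

(** The recurrence [hcoef_succ], multiplied by x^k and summed, equates x y'' + (M+1) y' with x^2 y''
    + (a+b+1) x y' + a b y. *)
Lemma hs_ode a b M x : Rabs x < 1 ->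
  x * (1 - x) * hs2 a b M x + (INR M + 1 - (a + b + 1) * x) * hs1 a b M x
    - a * b * hs a b M x = 0.
Proof.
  intros Hx. set (u := hcoef a b M).
  assert (H0 : is_pseries u x (hs a b M x)).
  { apply PSeries_correct, CV_radius_inside, hcoef_radius, Hx. }
  assert (H1 : is_pseries (PS_derive u) x (hs1 a b M x)).
  { apply PSeries_correct, CV_radius_inside. rewrite CV_radius_derive.
    apply hcoef_radius, Hx. }
  assert (H2 : is_pseries (PS_derive (PS_derive u)) x (hs2 a b M x)).
  { apply PSeries_correct, CV_radius_inside. rewrite !CV_radius_derive.
    apply hcoef_radius, Hx. }
  assert (HL : is_pseries (fun k => (INR k + 1) * (INR M + 1 + INR k) * u (S k)) x
      (x * hs2 a b M x + (INR M + 1) * hs1 a b M x)).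
  { eapply is_pseries_ext; [|apply (is_pseries_plus _ _ _ _ _
      (is_pseries_incr_1 _ _ _ H2)
      (is_pseries_scal (INR M + 1) _ _ _ (Rmult_comm _ _) H1))].
    intros [|k]; unfold PS_plus, PS_incr_1, PS_scal, PS_derive, plus, scal, zero; simpl;
      unfold mult; simpl; rewrite ?S_INR; simpl; ring. }
  assert (HR : is_pseries (fun k => (a + INR k) * (b + INR k) * u k) x
      (x * (x * hs2 a b M x) + ((a + b + 1) * (x * hs1 a b M x) + a * b * hs a b M x))).
  { eapply is_pseries_ext; [|apply (is_pseries_plus _ _ _ _ _
      (is_pseries_incr_1 _ _ _ (is_pseries_incr_1 _ _ _ H2))
      (is_pseries_plus _ _ _ _ _
        (is_pseries_scal (a + b + 1) _ _ _ (Rmult_comm _ _) (is_pseries_incr_1 _ _ _ H1))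
        (is_pseries_scal (a * b) _ _ _ (Rmult_comm _ _) H0)))].
    intros [|[|k]]; unfold PS_plus, PS_incr_1, PS_scal, PS_derive, plus, scal, zero; simpl;
      unfold mult; simpl; ring. }
  apply is_pseries_unique in HL. apply is_pseries_unique in HR.
  unfold u in HL. rewrite (PSeries_ext _ _ x (hcoef_succ a b M)) in HL.
  unfold u in HR. rewrite HL in HR. lra.
Qed.

Lemma hs_0 a b M : hs a b M 0 = / INR (fact M).
Proof.
  unfold hs. rewrite PSeries_0. unfold hcoef. rewrite Nat.add_0_r. simpl. field.
  apply INR_fact_neq_0.
Qed.

Lemma PSeries_nonneg (u : nat -> R) (x : R) :
  (forall k, 0 <= u k) -> 0 <= x -> ex_pseries u x -> 0 <= PSeries u x.
Proof.
  intros Hu Hx Hex.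
  rewrite <- (PSeries_const_0 x). unfold PSeries. apply Series_le.
  - intros k. assert (0 <= u k * x ^ k) by (apply Rmult_le_pos; [apply Hu|now apply pow_le]).
    lra.
  - now apply ex_pseries_R.
Qed.

Lemma hs_pos a b M x : 0 < a -> 0 < b -> 0 <= x < 1 -> 0 < hs a b M x.
Proof.
  intros Ha Hb Hx.
  assert (Hc : forall k, 0 < hcoef a b M k).
  { intros k. apply Rdiv_lt_0_compat.
    - apply Rmult_lt_0_compat; now apply poch_pos.
    - apply Rmult_lt_0_compat; apply INR_fact_lt_0. }
  assert (Hr : Rbar_lt (Rabs x) (CV_radius (hcoef a b M)))
    by (apply hcoef_radius; rewrite Rabs_pos_eq; lra).
  unfold hs. rewrite PSeries_decr_1 by now apply CV_radius_inside.
  specialize (Hc 0%nat) as H0.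
  assert (0 <= x * PSeries (PS_decr_1 (hcoef a b M)) x); [|lra].
  apply Rmult_le_pos; [lra|]. apply PSeries_nonneg; [|lra|].
  - intros k; left; apply Hc.
  - apply CV_radius_inside. now rewrite CV_radius_decr_1.
Qed.

(** * Uniqueness of the regular solution *)

(** Abel's identity: [A p' = B p] makes [p] times the Wronskian constant. Since [l] is a singular
    point, [p] vanishes there, so this constant is 0 for any two solutions differentiable at [l]; no
    expansion at the singular point is required. *)
Lemma regular_solution_ratio (A B C p dp y y1 y2 v v1 v2 : R -> R) (l u : R) :
  l <= u ->
  (forall x, l <= x <= u -> is_derive y x (y1 x)) ->
  (forall x, l <= x <= u -> is_derive y1 x (y2 x)) ->
  (forall x, l <= x <= u -> is_derive v x (v1 x)) ->
  (forall x, l <= x <= u -> is_derive v1 x (v2 x)) ->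
  (forall x, l <= x <= u -> is_derive p x (dp x)) ->
  (forall x, l <= x <= u -> A x * y2 x + B x * y1 x + C x * y x = 0) ->
  (forall x, l <= x <= u -> A x * v2 x + B x * v1 x + C x * v x = 0) ->
  (forall x, l <= x <= u -> A x * dp x = B x * p x) ->
  (forall x, l < x <= u -> A x <> 0) ->
  (forall x, l < x <= u -> p x <> 0) ->
  p l = 0 ->
  (forall x, l <= x <= u -> v x <> 0) ->
  y u * v l = y l * v u.
Proof.
  intros [Hlu|Hlu] Hy Hy1 Hv Hv1 Hp Ey Ev Ep HA Hp0 Hpl Hv0;
    [|subst; ring].
  assert (HW : forall x, l < x <= u -> y1 x * v x - y x * v1 x = 0).
  { intros x Hx.
    destruct (MVT_cor2 (fun x => p x * (y1 x * v x - y x * v1 x))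
      (fun x => dp x * (y1 x * v x - y x * v1 x) + p x * (y2 x * v x - y x * v2 x)) l x)
      as [c [Hc Hlc]]; [lra| |].
    - intros c Hc. apply is_derive_Reals.
      assert (Hc' : l <= c <= u) by lra.
      evar_last.
      + apply (is_derive_mult p (fun x => y1 x * v x - y x * v1 x)).
        * now apply Hp.
        * apply (is_derive_minus (fun x => y1 x * v x) (fun x => y x * v1 x)).
          -- apply (is_derive_mult y1 v); [now apply Hy1|now apply Hv|apply Rmult_comm].
          -- apply (is_derive_mult y v1); [now apply Hy|now apply Hv1|apply Rmult_comm].
        * apply Rmult_comm.
      + unfold plus, mult, minus, opp; simpl; unfold plus; simpl. ring.
    - assert (Hc' : l <= c <= u) by lra.
      specialize (Ey c Hc'). specialize (Ev c Hc'). specialize (Ep c Hc').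
      assert (H0 : dp c * (y1 c * v c - y c * v1 c) + p c * (y2 c * v c - y c * v2 c) = 0).
      { apply Rmult_eq_reg_l with (A c); [|apply HA; lra].
        rewrite Rmult_plus_distr_l, <- Rmult_assoc, Ep.
        replace (A c * (p c * (y2 c * v c - y c * v2 c)))
          with (p c * (A c * y2 c * v c - y c * (A c * v2 c))) by ring.
        replace (A c * y2 c) with (- (B c * y1 c + C c * y c)) by lra.
        replace (A c * v2 c) with (- (B c * v1 c + C c * v c)) by lra.
        ring. }
      rewrite H0, Hpl, !Rmult_0_l, Rminus_0_r in Hc.
      apply Rmult_integral in Hc. destruct Hc as [Hc|Hc]; [|easy].
      exfalso; apply (Hp0 x); easy. }
  (* The Wronskian is known to vanish only to the right of [l]; the mean value point lies strictly
     inside, so the quotient has the same value at both ends. *)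
  destruct (MVT_cor2 (fun x => y x / v x)
    (fun x => (y1 x * v x - y x * v1 x) / v x ^ 2) l u) as [c [Hc Hlc]]; [lra| |].
  - intros c Hc. apply is_derive_Reals.
    evar_last.
    + apply (is_derive_div y v); [now apply Hy|now apply Hv|now apply Hv0].
    + reflexivity.
  - rewrite HW in Hc by lra.
    assert (v l <> 0) by (apply Hv0; lra). assert (v u <> 0) by (apply Hv0; lra).
    assert (He : y u / v u = y l / v l) by (unfold Rdiv in *; lra).
    replace (y u) with (y u / v u * v u) by (field; easy).
    rewrite He. field; easy.
Qed.

(** * Gegenbauer functions *)

(* With [al = M + 1/2], the function F(al+n, al-n; al+1/2; (1-z)/2) / M!, transformed by
   Pfaff's formula so that the series converges for all [z > 0]. *)
Definition geg_pfaff (n : R) (M : nat) (z : R) : R :=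
  Rpower ((1 + z) / 2) (- (INR M + 1 / 2 + n))
  * hs (INR M + 1 / 2 + n) (n + 1 / 2) M ((z - 1) / (z + 1)).

Definition geg_pfaff1 (n : R) (M : nat) (z : R) : R :=
  let be := INR M + 1 / 2 + n in let t := (z - 1) / (z + 1) in
  Rpower ((1 + z) / 2) (- be)
  * (- be / (1 + z) * hs be (n + 1 / 2) M t + 2 / (z + 1) ^ 2 * hs1 be (n + 1 / 2) M t).

Definition geg_pfaff2 (n : R) (M : nat) (z : R) : R :=
  let be := INR M + 1 / 2 + n in let t := (z - 1) / (z + 1) in
  Rpower ((1 + z) / 2) (- be)
  * ((be ^ 2 + be) / (1 + z) ^ 2 * hs be (n + 1 / 2) M t
     - (4 * be + 4) / (z + 1) ^ 3 * hs1 be (n + 1 / 2) M t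
     + 4 / (z + 1) ^ 4 * hs2 be (n + 1 / 2) M t).

Lemma pfaff_arg_bound z : 0 < z -> Rabs ((z - 1) / (z + 1)) < 1.
Proof.
  intros Hz. apply Rabs_def1.
  - apply Rmult_lt_reg_r with (z + 1); [lra|]. unfold Rdiv.
    rewrite Rmult_assoc, Rinv_l; lra.
  - apply Rmult_lt_reg_r with (z + 1); [lra|]. unfold Rdiv.
    rewrite Rmult_assoc, Rinv_l; lra.
Qed.

Lemma is_derive_comp_R (f g : R -> R) x df dg :
  is_derive f (g x) df -> is_derive g x dg -> is_derive (fun t => f (g t)) x (dg * df).
Proof. intros Hf Hg. now apply (is_derive_comp f g x df dg). Qed.

Lemma is_derive_mult_R (f g : R -> R) x df dg :
  is_derive f x df -> is_derive g x dg ->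
  is_derive (fun t => f t * g t) x (df * g x + f x * dg).
Proof. intros Hf Hg. apply (is_derive_mult f g x df dg Hf Hg Rmult_comm). Qed.

Lemma is_derive_pfaff_arg z : 0 < z ->
  is_derive (fun z => (z - 1) / (z + 1)) z (2 / (z + 1) ^ 2).
Proof. intros Hz. auto_derive; [lra|field; lra]. Qed.

Lemma is_derive_pfaff_power be z : 0 < z ->
  is_derive (fun z => Rpower ((1 + z) / 2) (- be)) z
    (Rpower ((1 + z) / 2) (- be) * (- be / (1 + z))).
Proof.
  intros Hz. unfold Rpower. auto_derive; [lra|].
  change ((1 + z) * / 2) with ((1 + z) / 2). field; lra.
Qed.

Lemma is_derive_geg_pfaff n M z : 0 < z ->
  is_derive (geg_pfaff n M) z (geg_pfaff1 n M z).
Proof.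
  intros Hz. unfold geg_pfaff, geg_pfaff1. cbv zeta.
  evar_last.
  - apply is_derive_mult_R.
    + now apply is_derive_pfaff_power.
    + apply (is_derive_comp_R (hs _ _ M) (fun z => (z - 1) / (z + 1))).
      * apply is_derive_hs. now apply pfaff_arg_bound.
      * now apply is_derive_pfaff_arg.
  - simpl. field; lra.
Qed.

Lemma is_derive_geg_pfaff1 n M z : 0 < z ->
  is_derive (geg_pfaff1 n M) z (geg_pfaff2 n M z).
Proof.
  intros Hz. unfold geg_pfaff1, geg_pfaff2. cbv zeta.
  set (be := INR M + 1 / 2 + n).
  evar_last.
  - apply is_derive_mult_R.
    + now apply is_derive_pfaff_power.
    + apply (is_derive_plus (fun z => - be / (1 + z) * hs be (n + 1 / 2) M ((z - 1) / (z + 1)))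
         (fun z => 2 / (z + 1) ^ 2 * hs1 be (n + 1 / 2) M ((z - 1) / (z + 1)))).
      * apply is_derive_mult_R.
        -- instantiate (1 := be / (1 + z) ^ 2). auto_derive; [lra|field; lra].
        -- apply (is_derive_comp_R (hs _ _ M) (fun z => (z - 1) / (z + 1))).
           ++ apply is_derive_hs. now apply pfaff_arg_bound.
           ++ now apply is_derive_pfaff_arg.
      * apply is_derive_mult_R.
        -- instantiate (1 := - 4 / (1 + z) ^ 3). auto_derive; [nra|field; lra].
        -- apply (is_derive_comp_R (hs1 _ _ M) (fun z => (z - 1) / (z + 1))).
           ++ apply is_derive_hs1. now apply pfaff_arg_bound.
           ++ now apply is_derive_pfaff_arg.
  - unfold plus; simpl. field; lra.
Qed.

Lemma geg_pfaff_ode n M z : 0 < z ->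
  (z ^ 2 - 1) * geg_pfaff2 n M z + (2 * INR M + 2) * z * geg_pfaff1 n M z
    + ((INR M + 1 / 2) ^ 2 - n ^ 2) * geg_pfaff n M z = 0.
Proof.
  intros Hz. unfold geg_pfaff, geg_pfaff1, geg_pfaff2. cbv zeta.
  set (be := INR M + 1 / 2 + n). set (t := (z - 1) / (z + 1)).
  pose proof (hs_ode be (n + 1 / 2) M t (pfaff_arg_bound z Hz)) as H.
  set (f := hs _ _ _ _) in *. set (f1 := hs1 _ _ _ _) in *. set (f2 := hs2 _ _ _ _) in *.
  set (E := Rpower _ _).
  (* The factor [2 / (z + 1)] is (z^2 - 1) t'^2 / (t (1 - t)), which matches the coefficients of the
     second derivative. *)
  transitivity (E * (2 / (z + 1)) *
    (t * (1 - t) * f2 + (INR M + 1 - (be + (n + 1 / 2) + 1) * t) * f1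
     - be * (n + 1 / 2) * f)); [|rewrite H; ring].
  unfold t, be. field. lra.
Qed.

(** The regular solution before Pfaff's transformation. Its series converges for -1 < z < 3, and it
    is the one that appears in P^M below z = 3 once the vanishing terms are removed. *)
Definition geg (n : R) (M : nat) (z : R) : R :=
  hs (INR M + 1 / 2 + n) (INR M + 1 / 2 - n) M ((1 - z) / 2).

Definition geg1 (n : R) (M : nat) (z : R) : R :=
  - / 2 * hs1 (INR M + 1 / 2 + n) (INR M + 1 / 2 - n) M ((1 - z) / 2).

Definition geg2 (n : R) (M : nat) (z : R) : R :=
  / 4 * hs2 (INR M + 1 / 2 + n) (INR M + 1 / 2 - n) M ((1 - z) / 2).

Lemma is_derive_geg n M z : -1 < z < 3 -> is_derive (geg n M) z (geg1 n M z).
Proof.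
  intros Hz. unfold geg, geg1.
  apply (is_derive_comp_R (hs _ _ M) (fun z => (1 - z) / 2)).
  - apply is_derive_hs, Rabs_def1; lra.
  - auto_derive; [auto|field].
Qed.

Lemma is_derive_geg1 n M z : -1 < z < 3 -> is_derive (geg1 n M) z (geg2 n M z).
Proof.
  intros Hz. unfold geg1, geg2.
  evar_last.
  - apply (is_derive_scal (fun z => hs1 _ _ M ((1 - z) / 2))).
    apply (is_derive_comp_R (hs1 _ _ M) (fun z => (1 - z) / 2)).
    + apply is_derive_hs1, Rabs_def1; lra.
    + instantiate (1 := - / 2). auto_derive; [auto|field].
  - simpl. field.
Qed.

Lemma geg_ode n M z : -1 < z < 3 ->
  (z ^ 2 - 1) * geg2 n M z + (2 * INR M + 2) * z * geg1 n M z
    + ((INR M + 1 / 2) ^ 2 - n ^ 2) * geg n M z = 0.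
Proof.
  intros Hz. unfold geg, geg1, geg2.
  assert (Hx : Rabs ((1 - z) / 2) < 1) by (apply Rabs_def1; lra).
  pose proof (hs_ode (INR M + 1 / 2 + n) (INR M + 1 / 2 - n) M _ Hx) as H.
  set (f := hs _ _ _ _) in *. set (f1 := hs1 _ _ _ _) in *. set (f2 := hs2 _ _ _ _) in *.
  match type of H with ?L = 0 => transitivity (- L); [|rewrite H; ring] end.
  field.
Qed.

(** All coefficients are positive for [n >= 0], and the argument is non-negative; this permits
    division by [geg_pfaff] in the Wronskian argument. *)
Lemma geg_pfaff_pos n M z : 0 <= n -> 1 <= z -> 0 < geg_pfaff n M z.
Proof.
  intros Hn Hz. unfold geg_pfaff. pose proof (pos_INR M).
  apply Rmult_lt_0_compat; [apply exp_pos|].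
  apply hs_pos; [lra|lra|]. split.
  - apply Rdiv_le_0_compat; lra.
  - pose proof (pfaff_arg_bound z ltac:(lra)) as H1. apply Rabs_def2 in H1; lra.
Qed.

Lemma geg_pfaff_1 n M : geg_pfaff n M 1 = / INR (fact M).
Proof.
  unfold geg_pfaff. replace ((1 + 1) / 2) with 1 by field.
  replace ((1 - 1) / (1 + 1)) with 0 by field.
  rewrite hs_0. unfold Rpower. rewrite ln_1, Rmult_0_r, exp_0. ring.
Qed.

Lemma geg_regular_solution (n : R) (M : nat) (y y1 y2 : R -> R) (Z : R) :
  1 <= Z -> 0 <= n ->
  (forall z, 1 <= z <= Z -> is_derive y z (y1 z)) ->
  (forall z, 1 <= z <= Z -> is_derive y1 z (y2 z)) ->
  (forall z, 1 <= z <= Z -> (z ^ 2 - 1) * y2 z + (2 * INR M + 2) * z * y1 z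
    + ((INR M + 1 / 2) ^ 2 - n ^ 2) * y z = 0) ->
  y Z = INR (fact M) * y 1 * geg_pfaff n M Z.
Proof.
  intros HZ Hn Hy Hy1 Ey.
  assert (H : y Z * geg_pfaff n M 1 = y 1 * geg_pfaff n M Z).
  (* The integrating factor of the Gegenbauer equation is (z^2 - 1)^(M+1), which vanishes at z =
     1. *)
  { apply (regular_solution_ratio (fun z => z ^ 2 - 1) (fun z => (2 * INR M + 2) * z)
      (fun _ => (INR M + 1 / 2) ^ 2 - n ^ 2) (fun z => (z ^ 2 - 1) ^ S M)
      (fun z => (INR M + 1) * (2 * z) * (z ^ 2 - 1) ^ M)
      y y1 y2 (geg_pfaff n M) (geg_pfaff1 n M) (geg_pfaff2 n M)); try assumption.
    - intros x Hx; apply is_derive_geg_pfaff; lra.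
    - intros x Hx; apply is_derive_geg_pfaff1; lra.
    - intros x Hx. evar_last.
      + apply (is_derive_pow (fun z => z ^ 2 - 1)). auto_derive; [auto|reflexivity].
      + simpl Init.Nat.pred. rewrite S_INR. ring.
    - intros x Hx; apply geg_pfaff_ode; lra.
    - intros x Hx; simpl; ring.
    - intros x Hx; nra.
    - intros x Hx; apply pow_nonzero; nra.
    - simpl; ring.
    - intros x Hx; apply Rgt_not_eq, geg_pfaff_pos; lra. }
  rewrite geg_pfaff_1 in H.
  pose proof (INR_fact_neq_0 M).
  replace (y Z) with (INR (fact M) * (y Z * / INR (fact M))) by (field; easy).
  rewrite H; ring.
Qed.

(** The equation contains [n] only through [n^2], and the value at 1 is free of [n]. *)
Lemma geg_pfaff_abs n M z : 1 <= z -> geg_pfaff n M z = geg_pfaff (Rabs n) M z.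
Proof.
  intros Hz.
  rewrite (geg_regular_solution (Rabs n) M (geg_pfaff n M) (geg_pfaff1 n M) (geg_pfaff2 n M));
    [|easy|apply Rabs_pos|..].
  - rewrite geg_pfaff_1. field. apply INR_fact_neq_0.
  - intros x Hx; apply is_derive_geg_pfaff; lra.
  - intros x Hx; apply is_derive_geg_pfaff1; lra.
  - intros x Hx. rewrite pow2_abs. apply geg_pfaff_ode; lra.
Qed.

Lemma geg_eq_pfaff n M z : 1 <= z < 3 -> geg n M z = geg_pfaff (Rabs n) M z.
Proof.
  intros Hz.
  rewrite (geg_regular_solution (Rabs n) M (geg n M) (geg1 n M) (geg2 n M));
    [|easy|apply Rabs_pos|..].
  - unfold geg. replace ((1 - 1) / 2) with 0 by field. rewrite hs_0.
    field. apply INR_fact_neq_0.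
  - intros x Hx; apply is_derive_geg; lra.
  - intros x Hx; apply is_derive_geg1; lra.
  - intros x Hx. rewrite pow2_abs. apply geg_ode; lra.
Qed.

(* Euler's transformation for the third parameter [c = N + 1], where [c - a' - b' = M] for the
   parameters [a' = c - a], [b' = c - b] of the left-hand side. *)
Lemma hs_euler (a b : R) (M N : nat) (Y : R) :
  0 < a -> 0 < b -> a + b = INR N + 1 + INR M -> 0 <= Y < 1 ->
  hs (INR N + 1 - a) (INR N + 1 - b) N Y = (1 - Y) ^ M * hs a b N Y.
Proof.
  intros Ha Hb Hab HY.
  set (a' := INR N + 1 - a). set (b' := INR N + 1 - b).
  assert (Habs : forall x, 0 <= x <= Y -> Rabs x < 1)
    by (intros x Hx; rewrite Rabs_pos_eq; lra).
  pose (m := INR M).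
  pose (v := fun y => (1 - y) ^ M * hs a b N y).
  pose (v1 := fun y => (1 - y) ^ M * (- m / (1 - y) * hs a b N y + hs1 a b N y)).
  pose (v2 := fun y => (1 - y) ^ M * ((m ^ 2 - m) / (1 - y) ^ 2 * hs a b N y
     - 2 * m / (1 - y) * hs1 a b N y + hs2 a b N y)).
  assert (Hpow : forall x, 0 <= x <= Y ->
    is_derive (fun y => (1 - y) ^ M) x ((1 - x) ^ M * (- m / (1 - x)))).
  { intros x Hx. evar_last.
    - apply (is_derive_pow (fun y => 1 - y)). auto_derive; [auto|reflexivity].
    - unfold m. destruct M as [|M']; [simpl; field; lra|].
      simpl Init.Nat.pred. simpl pow. field. lra. }
  assert (H : hs a' b' N Y * v 0 = hs a' b' N 0 * v Y).
  (* The integrating factor is y^(N+1) (1-y)^(1-M), written with an inverse because 1 - M may be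
     negative. The positive solution [v] serves as the denominator, since the parameters [a'], [b']
     may be negative. *)
  { apply (regular_solution_ratio (fun y => y * (1 - y))
      (fun y => INR N + 1 - (a' + b' + 1) * y) (fun _ => - (a' * b'))
      (fun y => y ^ S N * ((1 - y) * / (1 - y) ^ M))
      (fun y => (INR N + 1) * y ^ N * ((1 - y) * / (1 - y) ^ M)
         + y ^ S N * ((m - 1) * / (1 - y) ^ M))
      (hs a' b' N) (hs1 a' b' N) (hs2 a' b' N) v v1 v2); [lra|..].
    - intros x Hx; apply is_derive_hs, Habs, Hx.
    - intros x Hx; apply is_derive_hs1, Habs, Hx.
    - intros x Hx. unfold v, v1. evar_last.
      + apply is_derive_mult_R; [now apply Hpow|apply is_derive_hs, Habs, Hx].
      + simpl. field. lra.
    - intros x Hx. unfold v1, v2. evar_last.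
      + apply is_derive_mult_R; [now apply Hpow|].
        apply (is_derive_plus (fun y => - m / (1 - y) * hs a b N y) (hs1 a b N)).
        * apply is_derive_mult_R; [|apply is_derive_hs, Habs, Hx].
          instantiate (1 := - m / (1 - x) ^ 2). auto_derive; [lra|field; lra].
        * apply is_derive_hs1, Habs, Hx.
      + unfold plus; simpl. field. lra.
    - intros x Hx. assert (Hx1 : (1 - x) ^ M <> 0) by (apply pow_nonzero; lra).
      evar_last.
      + apply is_derive_mult_R.
        * apply (is_derive_pow (fun y => y)). auto_derive; [auto|reflexivity].
        * apply is_derive_mult_R; [auto_derive; [auto|reflexivity]|].
          apply (is_derive_inv (fun y => (1 - y) ^ M)); [now apply Hpow|easy].
      + simpl Init.Nat.pred. rewrite S_INR. field. lra.
    - intros x Hx. pose proof (hs_ode a' b' N x (Habs x Hx)). lra.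
    - intros x Hx. pose proof (hs_ode a b N x (Habs x Hx)) as H.
      unfold v, v1, v2.
      assert (Hb' : b = INR N + 1 + m - a) by (unfold m; lra).
      set (f := hs _ _ _ _) in *. set (f1 := hs1 _ _ _ _) in *. set (f2 := hs2 _ _ _ _) in *.
      match type of H with ?L = 0 => transitivity ((1 - x) ^ M * L); [|rewrite H; ring] end.
      unfold a', b'. rewrite Hb'. field. lra.
    - intros x Hx. assert (Hx1 : (1 - x) ^ M <> 0) by (apply pow_nonzero; lra).
      replace (a' + b') with (INR N + 1 - m) by (unfold a', b', m; lra).
      simpl pow. field. easy.
    - intros x Hx. nra.
    - intros x Hx. repeat apply Rmult_integral_contrapositive_currified; try lra.
      + apply pow_nonzero; lra.
      + apply Rinv_neq_0_compat, pow_nonzero; lra.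
    - simpl; ring.
    - intros x Hx. unfold v. apply Rgt_not_eq, Rmult_lt_0_compat.
      + apply pow_lt; lra.
      + apply hs_pos; lra. }
  unfold v in H. rewrite !hs_0 in H. rewrite Rminus_0_r, pow1 in H.
  apply Rmult_eq_reg_r with (/ INR (fact N)); [lra|].
  apply Rinv_neq_0_compat, INR_fact_neq_0.
Qed.

(* [geg] after Euler's transformation F(a,b;c;x) = (1-x)^(c-a-b) F(c-a,c-b;c;x). *)
Definition geg_euler (n : R) (M : nat) (z : R) : R :=
  Rpower ((1 + z) / 2) (- INR M) * hs (n + 1 / 2) (1 / 2 - n) M ((1 - z) / 2).

Definition geg_euler1 (n : R) (M : nat) (z : R) : R :=
  Rpower ((1 + z) / 2) (- INR M) *
  (- INR M / (1 + z) * hs (n + 1 / 2) (1 / 2 - n) M ((1 - z) / 2)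
   - / 2 * hs1 (n + 1 / 2) (1 / 2 - n) M ((1 - z) / 2)).

Definition geg_euler2 (n : R) (M : nat) (z : R) : R :=
  Rpower ((1 + z) / 2) (- INR M) *
  ((INR M ^ 2 + INR M) / (1 + z) ^ 2 * hs (n + 1 / 2) (1 / 2 - n) M ((1 - z) / 2)
   + INR M / (1 + z) * hs1 (n + 1 / 2) (1 / 2 - n) M ((1 - z) / 2)
   + / 4 * hs2 (n + 1 / 2) (1 / 2 - n) M ((1 - z) / 2)).

Lemma is_derive_geg_euler n M z : 0 < z < 3 ->
  is_derive (geg_euler n M) z (geg_euler1 n M z).
Proof.
  intros Hz. unfold geg_euler, geg_euler1. evar_last.
  - apply is_derive_mult_R; [now apply is_derive_pfaff_power|].
    apply (is_derive_comp_R (hs _ _ M) (fun z => (1 - z) / 2)).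
    + apply is_derive_hs, Rabs_def1; lra.
    + instantiate (1 := - / 2). auto_derive; [auto|field].
  - simpl. field. lra.
Qed.

Lemma is_derive_geg_euler1 n M z : 0 < z < 3 ->
  is_derive (geg_euler1 n M) z (geg_euler2 n M z).
Proof.
  intros Hz. unfold geg_euler1, geg_euler2. evar_last.
  - apply is_derive_mult_R; [now apply is_derive_pfaff_power|].
    apply (is_derive_minus
      (fun z => - INR M / (1 + z) * hs (n + 1 / 2) (1 / 2 - n) M ((1 - z) / 2))
      (fun z => / 2 * hs1 (n + 1 / 2) (1 / 2 - n) M ((1 - z) / 2))).
    + apply is_derive_mult_R.
      * instantiate (1 := INR M / (1 + z) ^ 2). auto_derive; [lra|field; lra].
      * apply (is_derive_comp_R (hs _ _ M) (fun z => (1 - z) / 2)).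
        -- apply is_derive_hs, Rabs_def1; lra.
        -- instantiate (1 := - / 2). auto_derive; [auto|field].
    + apply (is_derive_scal (fun z => hs1 _ _ M ((1 - z) / 2))).
      apply (is_derive_comp_R (hs1 _ _ M) (fun z => (1 - z) / 2)).
      * apply is_derive_hs1, Rabs_def1; lra.
      * instantiate (1 := - / 2). auto_derive; [auto|field].
  - unfold minus, plus, opp; simpl. field. lra.
Qed.

Lemma geg_euler_ode n M z : 0 < z < 3 ->
  (z ^ 2 - 1) * geg_euler2 n M z + (2 * INR M + 2) * z * geg_euler1 n M z
    + ((INR M + 1 / 2) ^ 2 - n ^ 2) * geg_euler n M z = 0.
Proof.
  intros Hz. unfold geg_euler, geg_euler1, geg_euler2.
  assert (Hx : Rabs ((1 - z) / 2) < 1) by (apply Rabs_def1; lra).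
  pose proof (hs_ode (n + 1 / 2) (1 / 2 - n) M _ Hx) as H.
  set (f := hs _ _ _ _) in *. set (f1 := hs1 _ _ _ _) in *. set (f2 := hs2 _ _ _ _) in *.
  set (E := Rpower _ _).
  match type of H with ?L = 0 => transitivity (- E * L); [|rewrite H; ring] end.
  field. lra.
Qed.

Lemma geg_euler_eq_pfaff n M z : 1 <= z < 3 -> geg_euler n M z = geg_pfaff (Rabs n) M z.
Proof.
  intros Hz.
  rewrite (geg_regular_solution (Rabs n) M (geg_euler n M) (geg_euler1 n M) (geg_euler2 n M));
    [|easy|apply Rabs_pos|..].
  - unfold geg_euler. replace ((1 - 1) / 2) with 0 by field. rewrite hs_0.
    replace ((1 + 1) / 2) with 1 by field. unfold Rpower. rewrite ln_1, Rmult_0_r, exp_0.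
    field. apply INR_fact_neq_0.
  - intros x Hx; apply is_derive_geg_euler; lra.
  - intros x Hx; apply is_derive_geg_euler1; lra.
  - intros x Hx. rewrite pow2_abs. apply geg_euler_ode; lra.
Qed.

(** * Legendre functions of half-integer degree *)

Lemma hyp2F1r_series_hs a b M x : hyp2F1r_series a b (INR M + 1) x = hs a b M x.
Proof.
  unfold hyp2F1r_series, hs, PSeries. apply Series_ext. intros k.
  replace (INR M + 1 + INR k) with (INR (M + k) + 1) by (rewrite plus_INR; ring).
  rewrite rGamma_INR_succ. unfold hcoef. field.
  split; apply INR_fact_neq_0.
Qed.

(** The first [M] terms carry 1/Gamma at 1-M, ..., 0 and vanish; reindexing the rest raises every
    parameter by [M]. *)
Lemma hyp2F1r_series_shift a b M x :
  hyp2F1r_series a b (1 - INR M) x =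
  poch a M * poch b M * x ^ M * hs (a + INR M) (b + INR M) M x.
Proof.
  unfold hyp2F1r_series, hs, PSeries.
  rewrite (Series_incr_n_aux _ M).
  - rewrite <- Series_scal_l. apply Series_ext. intros k.
    replace (1 - INR M + INR (M + k)) with (INR k + 1) by (rewrite plus_INR; ring).
    rewrite rGamma_INR_succ. unfold hcoef. rewrite !poch_add, pow_add. field.
    split; apply INR_fact_neq_0.
  - intros k Hk.
    replace (1 - INR M + INR k) with (- INR (M - 1 - k)).
    + rewrite rGamma_opp_INR. unfold Rdiv; ring.
    + rewrite !minus_INR by lia. simpl; ring.
Qed.

Lemma Rpower_sqr_half y m : 0 < y -> Rpower (y ^ 2) (IZR m / 2) = powerRZ y m.
Proof.
  intros Hy. rewrite <- (Rpower_pow 2 y) by easy. rewrite Rpower_mult.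
  rewrite powerRZ_Rpower by easy. f_equal. simpl; field.
Qed.

(** Since (z+1)/(z-1) = ((z+1)/S)^2, the half-integer power becomes an integer power. Later [S] is a
    hyperbolic sine, so no root has to be simplified. *)
Lemma LegendreP_prefactor m z S : 1 < z -> 0 < S -> S ^ 2 = z ^ 2 - 1 ->
  Rpower ((z + 1) / (z - 1)) (IZR m / 2) = powerRZ ((z + 1) / S) m.
Proof.
  intros Hz HS HS2. rewrite <- Rpower_sqr_half by (apply Rdiv_lt_0_compat; lra).
  f_equal. replace (((z + 1) / S) ^ 2) with ((z + 1) ^ 2 / S ^ 2) by (field; lra).
  rewrite HS2. field. split; nra.
Qed.

Lemma powerRZ_opp_nat x M : powerRZ x (- Z.of_nat M) = / x ^ M.
Proof. now rewrite powerRZ_neg', <- pow_powerRZ. Qed.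

Lemma LegendreP_neg n M z S : 1 < z -> 0 < S -> S ^ 2 = z ^ 2 - 1 ->
  LegendreP (- Z.of_nat M) (IZR n - 1 / 2) z =
  (S / 2) ^ M * geg_pfaff (Rabs (IZR n)) M z.
Proof.
  intros Hz HS HS2. unfold LegendreP. rewrite LegendreP_prefactor with (S := S) by easy.
  assert (Hq : (z + 1) / S <> 0) by (apply Rgt_not_eq, Rdiv_lt_0_compat; lra).
  rewrite powerRZ_opp_nat by easy.
  rewrite opp_IZR, <- INR_IZR_INZ.
  replace (1 - - INR M) with (INR M + 1) by ring.
  replace (IZR n - 1 / 2 + 1) with (IZR n + 1 / 2) by field.
  replace (- (IZR n - 1 / 2)) with (1 / 2 - IZR n) by ring.
  assert (Hp : / ((z + 1) / S) ^ M = (S / 2) ^ M * / ((1 + z) / 2) ^ M).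
  { rewrite <- !pow_inv, <- Rpow_mult_distr. f_equal. field. lra. }
  rewrite Hp, Rmult_assoc. f_equal.
  (* The test |(1-z)/2| < 1 means z < 3. Below 3 the series is [geg_euler]; from 3 on, the Pfaff
     branch is [geg_pfaff] itself up to the sign of [n]. *)
  unfold hyp2F1r. destruct (Rlt_dec _ _) as [Hx|Hx].
  - apply Rabs_def2 in Hx. rewrite hyp2F1r_series_hs.
    rewrite <- geg_euler_eq_pfaff by lra.
    unfold geg_euler. rewrite Rpower_Ropp, Rpower_pow by lra. easy.
  - rewrite <- geg_pfaff_abs by lra. unfold geg_pfaff.
    replace ((1 - z) / 2 / ((1 - z) / 2 - 1)) with ((z - 1) / (z + 1)) by (field; lra).
    replace (INR M + 1 - (1 / 2 - IZR n)) with (INR M + 1 / 2 + IZR n) by field.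
    rewrite hyp2F1r_series_hs.
    replace (1 - (1 - z) / 2) with ((1 + z) / 2) by field.
    rewrite (hs_sym _ (INR M + 1 / 2 + IZR n)).
    replace (- (INR M + 1 / 2 + IZR n)) with (- INR M + - (IZR n + 1 / 2)) by ring.
    rewrite Rpower_plus, (Rpower_Ropp _ (INR M)), Rpower_pow by lra. ring.
Qed.

(** The constant is Gamma(n+M+1/2)/Gamma(n-M+1/2), the classical ratio of P^M to P^(-M). It arises
    from the two Pochhammer symbols of the index shift, one of them reflected when z < 3. *)
Lemma LegendreP_pos n M z S : 1 < z -> 0 < S -> S ^ 2 = z ^ 2 - 1 ->
  LegendreP (Z.of_nat M) (IZR n - 1 / 2) z =
  poch (IZR n + 1 / 2 - INR M) (2 * M) * ((S / 2) ^ M * geg_pfaff (Rabs (IZR n)) M z).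
Proof.
  intros Hz HS HS2. unfold LegendreP. rewrite LegendreP_prefactor with (S := S) by easy.
  assert (Hq : (z + 1) / S <> 0) by (apply Rgt_not_eq, Rdiv_lt_0_compat; lra).
  rewrite <- pow_powerRZ, <- INR_IZR_INZ.
  replace (IZR n - 1 / 2 + 1) with (IZR n + 1 / 2) by field.
  replace (- (IZR n - 1 / 2)) with (1 / 2 - IZR n) by ring.
  replace (2 * M)%nat with (M + M)%nat by lia. rewrite poch_add.
  replace (IZR n + 1 / 2 - INR M + INR M) with (IZR n + 1 / 2) by ring.
  assert (HSz : S / (z - 1) = (z + 1) / S).
  { apply Rmult_eq_reg_r with (S * (z - 1)); [|nra].
    replace (S / (z - 1) * (S * (z - 1))) with (S ^ 2) by (field; lra).
    rewrite HS2. field; lra. }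
  unfold hyp2F1r. destruct (Rlt_dec _ _) as [Hx|Hx].
  - apply Rabs_def2 in Hx. rewrite hyp2F1r_series_shift.
    rewrite <- geg_eq_pfaff by lra. unfold geg.
    replace (IZR n + 1 / 2 + INR M) with (INR M + 1 / 2 + IZR n) by ring.
    replace (1 / 2 - IZR n + INR M) with (INR M + 1 / 2 - IZR n) by ring.
    rewrite (poch_reflection (1 / 2 - IZR n)).
    replace (1 - (1 / 2 - IZR n) - INR M) with (IZR n + 1 / 2 - INR M) by field.
    assert (Hp : ((z + 1) / S) ^ M * (-1) ^ M * ((1 - z) / 2) ^ M = (S / 2) ^ M).
    { rewrite <- !Rpow_mult_distr. f_equal. rewrite <- HSz. field. lra. }
    rewrite <- Hp. ring.
  - rewrite <- geg_pfaff_abs by lra. unfold geg_pfaff.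
    replace ((1 - z) / 2 / ((1 - z) / 2 - 1)) with ((z - 1) / (z + 1)) by (field; lra).
    replace (1 - INR M - (1 / 2 - IZR n)) with (IZR n + 1 / 2 - INR M) by field.
    rewrite hyp2F1r_series_shift.
    replace (IZR n + 1 / 2 + INR M) with (INR M + 1 / 2 + IZR n) by ring.
    replace (IZR n + 1 / 2 - INR M + INR M) with (IZR n + 1 / 2) by ring.
    replace (1 - (1 - z) / 2) with ((1 + z) / 2) by field.
    replace (- (INR M + 1 / 2 + IZR n)) with (- INR M + - (IZR n + 1 / 2)) by ring.
    rewrite Rpower_plus, (Rpower_Ropp _ (INR M)), Rpower_pow by lra.
    assert (Hp : ((z + 1) / S) ^ M * ((z - 1) / (z + 1)) ^ M = (S / 2) ^ M * / ((1 + z) / 2) ^ M).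
    { rewrite <- !pow_inv, <- !Rpow_mult_distr. f_equal. rewrite <- HSz. field. lra. }
    transitivity (((z + 1) / S) ^ M * ((z - 1) / (z + 1)) ^ M *
      (Rpower ((1 + z) / 2) (- (IZR n + 1 / 2)) *
      (poch (IZR n + 1 / 2) M * poch (IZR n + 1 / 2 - INR M) M *
      hs (INR M + 1 / 2 + IZR n) (IZR n + 1 / 2) M ((z - 1) / (z + 1))))); [ring|].
    rewrite Hp. ring.
Qed.

(* [S] stands for [sqrt (z^2 - 1)]. *)
Definition legQ (m : Z) (N : nat) (z S : R) : R :=
  powerRZ (-1) m * sqrt PI * Gamma (IZR (m + Z.of_nat N) + 1 / 2) * powerRZ S m
  / (Rpower 2 (INR N + 1 / 2) * Rpower z (INR N + IZR m + 1 / 2))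
  * hs ((INR N + IZR m) / 2 + 3 / 4) ((INR N + IZR m) / 2 + 1 / 4) N (1 / z ^ 2).

Lemma inv_sqr_bound z : 1 < z -> 0 < 1 / z ^ 2 < 1.
Proof.
  intros Hz. assert (1 < z ^ 2) by nra. split.
  - apply Rdiv_lt_0_compat; lra.
  - apply Rmult_lt_reg_r with (z ^ 2); [lra|]. unfold Rdiv. rewrite Rmult_assoc, Rinv_l; lra.
Qed.

Lemma LegendreQ_nat m N z S : 1 < z -> 0 < S -> S ^ 2 = z ^ 2 - 1 ->
  LegendreQ m (INR N - 1 / 2) z = legQ m N z S.
Proof.
  intros Hz HS HS2. unfold LegendreQ, legQ.
  pose proof (inv_sqr_bound z Hz).
  rewrite <- HS2, Rpower_sqr_half by easy.
  rewrite plus_IZR, <- INR_IZR_INZ.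
  replace (INR N - 1 / 2 + IZR m + 1) with (IZR m + INR N + 1 / 2) by field.
  replace (INR N - 1 / 2 + 1) with (INR N + 1 / 2) by field.
  replace (INR N - 1 / 2 + 3 / 2) with (INR N + 1) by field.
  replace (INR N + IZR m + 1 / 2) with (IZR m + INR N + 1 / 2) by ring.
  unfold hyp2F1r. destruct (Rlt_dec _ _) as [Hx|Hx].
  - rewrite hyp2F1r_series_hs. f_equal. f_equal; field.
  - exfalso; apply Hx. rewrite Rabs_pos_eq; lra.
Qed.

(** Here the third parameter is 1 - N, so the first [N] terms vanish. The parameter [b] is half the
    Gamma argument; by duplication the factors [poch b N] and [poch (b + 1/2) N] left by the shift
    are what Gamma gains over 2N unit steps, and Q becomes even in [n]. *)
Lemma LegendreQ_opp_nat m N z S : 1 < z -> 0 < S -> S ^ 2 = z ^ 2 - 1 ->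
  LegendreQ m (- INR N - 1 / 2) z = legQ m N z S.
Proof.
  intros Hz HS HS2. unfold LegendreQ, legQ.
  pose proof (inv_sqr_bound z Hz).
  rewrite <- HS2, Rpower_sqr_half by easy.
  replace (- INR N - 1 / 2 + IZR m + 1) with (IZR (m - Z.of_nat N) + 1 / 2)
    by (rewrite minus_IZR, <- INR_IZR_INZ; field).
  replace (- INR N - 1 / 2 + 1) with (- INR N + 1 / 2) by field.
  replace (- INR N - 1 / 2 + 3 / 2) with (1 - INR N) by field.
  set (b := (IZR (m - Z.of_nat N) + 1 / 2) / 2).
  assert (Hb : b = (IZR m - INR N) / 2 + 1 / 4)
    by (unfold b; rewrite minus_IZR, <- INR_IZR_INZ; field).
  replace (IZR (m + Z.of_nat N) + 1 / 2)
    with (IZR (m - Z.of_nat N) + 1 / 2 + INR (2 * N))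
    by (rewrite mult_INR, minus_IZR, plus_IZR, <- INR_IZR_INZ; simpl; ring).
  rewrite Gamma_half_poch.
  replace (poch (IZR (m - Z.of_nat N) + 1 / 2) (2 * N)) with (poch (2 * b) (2 * N))
    by (f_equal; unfold b; field).
  rewrite poch_duplication.
  replace (IZR (m - Z.of_nat N) + 1 / 2) with (2 * b) by (unfold b; field).
  unfold hyp2F1r. destruct (Rlt_dec _ _) as [Hx|Hx];
    [|exfalso; apply Hx; rewrite Rabs_pos_eq; lra].
  replace ((- INR N - 1 / 2 + IZR m) / 2 + 1) with (b + 1 / 2) by (rewrite Hb; field).
  replace ((- INR N - 1 / 2 + IZR m + 1) / 2) with b by (rewrite Hb; field).
  rewrite hyp2F1r_series_shift.
  replace (b + 1 / 2 + INR N) with ((INR N + IZR m) / 2 + 3 / 4) by (rewrite Hb; field).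
  replace (b + INR N) with ((INR N + IZR m) / 2 + 1 / 4) by (rewrite Hb; field).
  set (F := hs _ _ _ _).
  replace (INR N + 1 / 2) with (- INR N + 1 / 2 + INR (2 * N))
    by (rewrite mult_INR; simpl; ring).
  replace (INR N + IZR m + 1 / 2) with (2 * b + INR (2 * N))
    by (rewrite Hb, mult_INR; simpl; field).
  rewrite !Rpower_plus, !Rpower_pow by lra.
  rewrite !pow_mult. replace (2 ^ 2) with 4 by ring.
  replace (1 / z ^ 2) with (/ z ^ 2) by (field; lra). rewrite pow_inv.
  field.
  repeat split; try (apply pow_nonzero; nra); apply Rgt_not_eq, exp_pos.
Qed.

Lemma LegendreQ_half m n z S : 1 < z -> 0 < S -> S ^ 2 = z ^ 2 - 1 ->
  LegendreQ m (IZR n - 1 / 2) z = legQ m (Z.abs_nat n) z S.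
Proof.
  intros Hz HS HS2. destruct (Z_le_dec 0 n) as [H|H].
  - rewrite <- (LegendreQ_nat _ _ z S) by easy. repeat f_equal.
    rewrite INR_IZR_INZ. f_equal. lia.
  - rewrite <- (LegendreQ_opp_nat _ _ z S) by easy. repeat f_equal.
    rewrite INR_IZR_INZ, <- opp_IZR. f_equal. lia.
Qed.

(** Euler's transformation contributes (1 - 1/z^2)^M = (S/z)^(2M), which turns S^(-M) into S^M and
    adjusts the power of z. *)
Lemma legQ_neg M N z S : 1 < z -> 0 < S -> S ^ 2 = z ^ 2 - 1 ->
  poch (INR N + 1 / 2 - INR M) (2 * M) * legQ (- Z.of_nat M) N z S = legQ (Z.of_nat M) N z S.
Proof.
  intros Hz HS HS2. unfold legQ.
  pose proof (inv_sqr_bound z Hz).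
  rewrite !powerRZ_opp_nat by lra. rewrite <- !pow_powerRZ, opp_IZR, <- INR_IZR_INZ.
  set (a := (INR N + INR M) / 2 + 3 / 4). set (b := (INR N + INR M) / 2 + 1 / 4).
  pose proof (pos_INR M). pose proof (pos_INR N).
  assert (HE := hs_euler a b M N (1 / z ^ 2) ltac:(unfold a; lra) ltac:(unfold b; lra)
    ltac:(unfold a, b; lra) ltac:(lra)).
  rewrite (hs_sym (INR N + 1 - a)) in HE.
  replace (INR N + 1 - b) with ((INR N + - INR M) / 2 + 3 / 4) in HE by (unfold b; field).
  replace (INR N + 1 - a) with ((INR N + - INR M) / 2 + 1 / 4) in HE by (unfold a; field).
  rewrite HE.
  replace (IZR (Z.of_nat M + Z.of_nat N) + 1 / 2)
    with (IZR (- Z.of_nat M + Z.of_nat N) + 1 / 2 + INR (2 * M))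
    by (rewrite mult_INR, !plus_IZR, opp_IZR, <- !INR_IZR_INZ; simpl; ring).
  rewrite Gamma_half_poch.
  replace (INR N + 1 / 2 - INR M) with (IZR (- Z.of_nat M + Z.of_nat N) + 1 / 2)
    by (rewrite !plus_IZR, opp_IZR, <- !INR_IZR_INZ; simpl; ring).
  set (G := Gamma _). set (p := poch _ _). set (F := hs _ _ _ _).
  replace (INR N + INR M + 1 / 2) with (INR N + - INR M + 1 / 2 + INR (2 * M))
    by (rewrite mult_INR; simpl; ring).
  rewrite (Rpower_plus _ (INR (2 * M))), Rpower_pow by lra.
  replace (1 - 1 / z ^ 2) with (S ^ 2 / z ^ 2) by (rewrite HS2; field; lra).
  assert (Hm : / (-1) ^ M = (-1) ^ M).
  { apply Rmult_eq_reg_l with ((-1) ^ M); [|apply pow_nonzero; lra].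
    rewrite Rinv_r by (apply pow_nonzero; lra). rewrite <- Rpow_mult_distr.
    replace (-1 * -1) with 1 by ring. now rewrite pow1. }
  rewrite Hm. unfold Rdiv. rewrite Rpow_mult_distr, pow_inv, <- !pow_mult.
  replace (S ^ (2 * M)) with (S ^ M * S ^ M)
    by (rewrite <- pow_add; f_equal; lia).
  field.
  repeat split; try (apply pow_nonzero; lra); apply Rgt_not_eq, exp_pos.
Qed.

(** The 2M factors n+1/2-M, ..., n-1/2+M are permuted by n -> -n up to sign, and their number is
    even. *)
Lemma poch_half_abs n M :
  poch (IZR n + 1 / 2 - INR M) (2 * M) = poch (INR (Z.abs_nat n) + 1 / 2 - INR M) (2 * M).
Proof.
  destruct (Z_le_dec 0 n) as [H|H].
  - rewrite (INR_IZR_INZ (Z.abs_nat n)). replace (Z.of_nat (Z.abs_nat n)) with n by lia. easy.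
  - rewrite poch_reflection, pow_1_even, Rmult_1_l. f_equal.
    replace (IZR n) with (- INR (Z.abs_nat n))
      by (rewrite INR_IZR_INZ, <- opp_IZR; f_equal; lia).
    rewrite mult_INR. simpl. field.
Qed.

Lemma Gamma_half_ratio n M :
  Gamma (IZR n + INR M + 1 / 2) =
  poch (IZR n + 1 / 2 - INR M) (2 * M) * Gamma (IZR n - INR M + 1 / 2) /\
  Gamma (IZR n - INR M + 1 / 2) <> 0 /\ poch (IZR n + 1 / 2 - INR M) (2 * M) <> 0.
Proof.
  replace (IZR n - INR M + 1 / 2) with (IZR (n - Z.of_nat M) + 1 / 2)
    by (rewrite minus_IZR, <- INR_IZR_INZ; ring).
  replace (IZR n + 1 / 2 - INR M) with (IZR (n - Z.of_nat M) + 1 / 2)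
    by (rewrite minus_IZR, <- INR_IZR_INZ; ring).
  replace (IZR n + INR M + 1 / 2) with (IZR (n - Z.of_nat M) + 1 / 2 + INR (2 * M))
    by (rewrite mult_INR, minus_IZR, <- INR_IZR_INZ; simpl; ring).
  split; [apply Gamma_half_poch|split; [apply Gamma_half_neq_0|apply poch_half_neq_0]].
Qed.

(** Reduces the right-hand side to |m| and |n|. For m = M the Gamma ratio cancels the constant of
    [LegendreP_pos]; for m = -M it is inverted and is absorbed by [legQ_neg]. *)
Lemma Gamma_ratio_PQ m n z S z' S' :
  1 < z -> 0 < S -> S ^ 2 = z ^ 2 - 1 -> 1 < z' -> 0 < S' -> S' ^ 2 = z' ^ 2 - 1 ->
  Gamma (IZR n - IZR m + 1 / 2) / Gamma (IZR n + IZR m + 1 / 2)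
  * LegendreP m (IZR n - 1 / 2) z * LegendreQ m (IZR n - 1 / 2) z' =
  (S / 2) ^ Z.abs_nat m * geg_pfaff (INR (Z.abs_nat n)) (Z.abs_nat m) z
  * legQ (Z.of_nat (Z.abs_nat m)) (Z.abs_nat n) z' S'.
Proof.
  intros Hz HS HS2 Hz' HS' HS2'. rewrite (LegendreQ_half m n z' S') by easy.
  remember (Z.abs_nat m) as M eqn:HM.
  assert (Hn : Rabs (IZR n) = INR (Z.abs_nat n)).
  { rewrite INR_IZR_INZ, <- abs_IZR. f_equal. lia. }
  destruct (Gamma_half_ratio n M) as [HG [HG0 Hp0]].
  destruct (Z_le_dec 0 m) as [H|H].
  - assert (m = Z.of_nat M) as -> by lia.
    rewrite (LegendreP_pos n M z S), Hn by easy.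
    rewrite <- INR_IZR_INZ, HG. field. easy.
  - assert (m = - Z.of_nat M)%Z as -> by lia.
    rewrite (LegendreP_neg n M z S), Hn by easy.
    rewrite opp_IZR, <- INR_IZR_INZ.
    replace (IZR n - - INR M + 1 / 2) with (IZR n + INR M + 1 / 2) by ring.
    replace (IZR n + - INR M + 1 / 2) with (IZR n - INR M + 1 / 2) by ring.
    rewrite <- (legQ_neg M _ z' S') by easy. rewrite HG, poch_half_abs.
    field. easy.
Qed.

(** * The generalized Heine integral *)

(** Equal parameters b = c = 1 cancel, so the binomial series inherits convergence and
    differentiation from [hs]. *)
Lemma hcoef_binomial al k : hcoef al 1 0 k = poch al k / INR (fact k).
Proof.
  unfold hcoef. pose proof (poch_INR 0 k) as H. simpl in H.
  rewrite Rplus_0_l, Rmult_1_r in H. rewrite H, Nat.add_0_l. field.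
  apply INR_fact_neq_0.
Qed.

Lemma hs1_binomial al x : Rabs x < 1 -> (1 - x) * hs1 al 1 0 x = al * hs al 1 0 x.
Proof.
  intros Hx. set (u := hcoef al 1 0).
  assert (H0 : is_pseries u x (hs al 1 0 x)).
  { apply PSeries_correct, CV_radius_inside, hcoef_radius, Hx. }
  assert (H1 : is_pseries (PS_derive u) x (hs1 al 1 0 x)).
  { apply PSeries_correct, CV_radius_inside. rewrite CV_radius_derive.
    apply hcoef_radius, Hx. }
  assert (HR : is_pseries (PS_derive u) x (x * hs1 al 1 0 x + al * hs al 1 0 x)).
  { eapply is_pseries_ext; [|apply (is_pseries_plus _ _ _ _ _
      (is_pseries_incr_1 _ _ _ H1)
      (is_pseries_scal al _ _ _ (Rmult_comm _ _) H0))].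
    assert (Hu : forall k, (INR k + 1) * u (S k) = (al + INR k) * u k).
    { intros k. unfold u. rewrite !hcoef_binomial, poch_S, fact_simpl, mult_INR, S_INR.
      pose proof (pos_INR k). field. split; [apply INR_fact_neq_0|lra]. }
    intros [|k]; unfold PS_plus, PS_incr_1, PS_scal, PS_derive, plus, scal, zero;
      cbv beta iota; [change plus with Rplus|]; unfold mult; simpl; unfold mult; simpl.
    - specialize (Hu 0%nat). simpl in Hu. lra.
    - specialize (Hu (S k)). rewrite S_INR in Hu. destruct k; simpl in *; lra. }
  apply is_pseries_unique in H1. apply is_pseries_unique in HR. lra.
Qed.

(** By [hs1_binomial] the product of the series with (1-t)^al has derivative 0, and it equals 1 at t
    = 0. *)
Lemma binomial_series al x : Rabs x < 1 -> hs al 1 0 x = Rpower (1 - x) (- al).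
Proof.
  intros Hx. apply Rabs_def2 in Hx.
  assert (Hd : forall t, Rmin 0 x <= t <= Rmax 0 x -> derivable_pt_lim
    (fun t => hs al 1 0 t * Rpower (1 - t) al) t ((fun _ => 0) t)).
  { intros t Ht. apply is_derive_Reals.
    assert (Ht' : -1 < t < 1).
    { unfold Rmin, Rmax in Ht. destruct (Rle_dec 0 x); lra. }
    assert (Hta : Rabs t < 1) by (apply Rabs_def1; lra).
    evar_last.
    - apply is_derive_mult_R; [now apply is_derive_hs|].
      unfold Rpower. auto_derive; [lra|reflexivity].
    - pose proof (hs1_binomial al t Hta) as H1. cbv beta.
      change (exp (al * ln (1 + - t))) with (Rpower (1 - t) al).
      set (E := Rpower _ _). change (1 + - t) with (1 - t).
      transitivity (/ (1 - t) * E * ((1 - t) * hs1 al 1 0 t - al * hs al 1 0 t));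
        [field; lra|rewrite H1; ring]. }
  destruct (MVT_abs _ _ 0 x Hd) as [c [Hc _]].
  rewrite Rabs_R0, Rmult_0_l in Hc. apply Rabs_eq_0 in Hc.
  rewrite hs_0, Rminus_0_r in Hc. unfold Rpower at 2 in Hc.
  rewrite ln_1, Rmult_0_r, exp_0 in Hc. simpl in Hc.
  rewrite Rpower_Ropp.
  assert (HE : 0 < Rpower (1 - x) al) by apply exp_pos.
  apply Rmult_eq_reg_r with (Rpower (1 - x) al); [|lra].
  rewrite Rinv_l by lra. lra.
Qed.

(** The integral of cos(t)^k cos(n t) over [0, PI], computed by the product-to-sum formula. An
    integer [n] lets the recursion pass through negative frequencies without case distinctions. *)
Fixpoint cos_moment (k : nat) (n : Z) : R :=
  match k with
  | O => if Z.eq_dec n 0 then PI else 0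
  | S k' => (cos_moment k' (n + 1) + cos_moment k' (n - 1)) / 2
  end.

Lemma sin_IZR_PI n : sin (IZR n * PI) = 0.
Proof. apply sin_eq_0_1. now exists n. Qed.

Lemma is_RInt_cos_moment k n :
  is_RInt (fun t => cos t ^ k * cos (IZR n * t)) 0 PI (cos_moment k n).
Proof.
  revert n; induction k as [|k IH]; intros n; simpl cos_moment.
  - destruct (Z.eq_dec n 0) as [->|Hn].
    + evar_last.
      * apply is_RInt_ext with (fun _ : R => 1);
          [|apply (is_RInt_const 0 PI (1 : R))].
        intros t _. simpl. rewrite Rmult_0_l, cos_0. ring.
      * unfold scal; simpl; unfold mult; simpl; ring.
    + assert (HZ : IZR n <> 0) by (intros H; apply Hn; now apply eq_IZR).
      evar_last.
      * apply (is_RInt_derive (fun t => sin (IZR n * t) / IZR n)).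
        -- intros t _. auto_derive; [auto|]. simpl. field. easy.
        -- intros t _. apply (ex_derive_continuous (fun t => cos t ^ 0 * cos (IZR n * t))).
           auto_derive; auto.
      * unfold minus, plus, opp; simpl. rewrite sin_IZR_PI, Rmult_0_r, sin_0. field; easy.
  - evar_last.
    + apply is_RInt_ext with (fun t => scal (/ 2)
        (plus (cos t ^ k * cos (IZR (n + 1) * t)) (cos t ^ k * cos (IZR (n - 1) * t)))).
      * intros t _. unfold scal, plus; simpl; unfold mult; simpl.
        rewrite plus_IZR, minus_IZR.
        replace ((IZR n + 1) * t) with (IZR n * t + t) by ring.
        replace ((IZR n - 1) * t) with (IZR n * t - t) by ring.
        rewrite cos_plus, cos_minus. field.
      * apply (is_RInt_scal (fun t => plus (cos t ^ k * cos (IZR (n + 1) * t))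
          (cos t ^ k * cos (IZR (n - 1) * t)))).
        apply (is_RInt_plus (fun t => cos t ^ k * cos (IZR (n + 1) * t))
          (fun t => cos t ^ k * cos (IZR (n - 1) * t))); apply IH.
    + unfold scal, plus; simpl; unfold mult; simpl. field.
Qed.

Lemma cos_moment_opp k n : cos_moment k (- n) = cos_moment k n.
Proof.
  revert n; induction k as [|k IH]; intros n; simpl.
  - destruct (Z.eq_dec n 0), (Z.eq_dec (- n) 0); lia || easy.
  - rewrite <- (IH (n + 1)%Z), <- (IH (n - 1)%Z).
    replace (- (n + 1))%Z with (- n - 1)%Z by ring.
    replace (- (n - 1))%Z with (- n + 1)%Z by ring.
    f_equal; ring.
Qed.

Lemma cos_moment_large k n : (Z.of_nat k < n)%Z -> cos_moment k n = 0.
Proof.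
  revert n; induction k as [|k IH]; intros n Hn; simpl.
  - destruct (Z.eq_dec n 0); lia || easy.
  - rewrite !IH by lia. field.
Qed.

Lemma cos_moment_odd k n : Z.odd (Z.of_nat k + n) = true -> cos_moment k n = 0.
Proof.
  revert n; induction k as [|k IH]; intros n Hn; simpl.
  - destruct (Z.eq_dec n 0); [subst; easy|easy].
  - rewrite Nat2Z.inj_succ in Hn.
    rewrite !IH; [field|..].
    + replace (Z.of_nat k + (n - 1))%Z with (Z.succ (Z.of_nat k) + n + 2 * (-1))%Z by ring.
      now rewrite Z.odd_add_mul_2.
    + now replace (Z.of_nat k + (n + 1))%Z with (Z.succ (Z.of_nat k) + n)%Z by ring.
Qed.

Lemma C_diag_n n : Binomial.C n n = 1.
Proof. unfold Binomial.C. rewrite Nat.sub_diag. simpl. field. apply INR_fact_neq_0. Qed.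

Lemma C_zero n : Binomial.C n 0 = 1.
Proof. unfold Binomial.C. rewrite Nat.sub_0_r. simpl. field. apply INR_fact_neq_0. Qed.

Lemma cos_moment_even k i : (i <= k)%nat ->
  cos_moment k (Z.of_nat k - 2 * Z.of_nat i) = PI / 2 ^ k * Binomial.C k i.
Proof.
  revert i; induction k as [|k IH]; intros i Hi.
  - assert (i = 0%nat) as -> by lia. rewrite C_zero. simpl. field.
  - cbn [cos_moment].
    assert (H2 : 2 ^ k <> 0) by (apply pow_nonzero; lra).
    destruct i as [|i].
    + rewrite cos_moment_large by lia.
      replace (Z.of_nat (S k) - 2 * Z.of_nat 0 - 1)%Z
        with (Z.of_nat k - 2 * Z.of_nat 0)%Z by lia.
      rewrite IH by lia. rewrite !C_zero. simpl. field. easy.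
    + replace (Z.of_nat (S k) - 2 * Z.of_nat (S i) + 1)%Z
        with (Z.of_nat k - 2 * Z.of_nat i)%Z by lia.
      replace (Z.of_nat (S k) - 2 * Z.of_nat (S i) - 1)%Z
        with (Z.of_nat k - 2 * Z.of_nat (S i))%Z by lia.
      rewrite IH by lia.
      (* At the edge [i = k] the second moment has frequency -(k+2), beyond the degree, and Pascal's
         rule degenerates to a single term. *)
      destruct (Nat.eq_dec i k) as [->|Hik].
      * rewrite <- cos_moment_opp, cos_moment_large by lia.
        rewrite !C_diag_n. simpl. field. easy.
      * rewrite IH by lia. rewrite <- pascal by lia. simpl. field. easy.
Qed.

(** The binomial coefficient replaces the factorial of N+2i by those of i and N+i, which makes the
    third parameter N+1. The powers of 4 from duplication cancel those of the moment. *)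
Lemma hs_duplication_coef al N i :
  hcoef al 1 0 (N + 2 * i) * cos_moment (N + 2 * i) (Z.of_nat N) =
  PI / 2 ^ N * poch al N * hcoef ((al + INR N + 1) / 2) ((al + INR N) / 2) N i.
Proof.
  replace (Z.of_nat N) with (Z.of_nat (N + 2 * i) - 2 * Z.of_nat i)%Z by lia.
  rewrite cos_moment_even by lia. rewrite hcoef_binomial. unfold hcoef, Binomial.C.
  replace (N + 2 * i - i)%nat with (N + i)%nat by lia.
  rewrite poch_add, pow_add, pow_mult.
  replace (al + INR N) with (2 * ((al + INR N) / 2)) at 1 by field.
  rewrite poch_duplication.
  replace ((al + INR N) / 2 + 1 / 2) with ((al + INR N + 1) / 2) by field.
  replace (2 ^ 2) with 4 by ring.
  field.
  repeat split; try apply INR_fact_neq_0; apply pow_nonzero; lra.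
Qed.

(** The bound is independent of [x]: this is the uniform convergence in [t] that allows integration
    term by term at [x = r cos t]. *)
Lemma sum_n_tail_bound (u : nat -> R) (r x : R) (K : nat) :
  ex_series (fun k => Rabs (u k) * r ^ k) -> Rabs x <= r ->
  Rabs (sum_n (fun k => u k * x ^ k) K - PSeries u x) <=
  Series (fun k => Rabs (u k) * r ^ k) - sum_n (fun k => Rabs (u k) * r ^ k) K.
Proof.
  intros Hex Hx.
  assert (Hr : 0 <= r) by (apply Rle_trans with (2 := Hx), Rabs_pos).
  assert (Hle : forall k, Rabs (u k * x ^ k) <= Rabs (u k) * r ^ k).
  { intros k. rewrite Rabs_mult, <- RPow_abs. apply Rmult_le_compat_l; [apply Rabs_pos|].
    apply pow_incr. split; [apply Rabs_pos|easy]. }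
  assert (HexA : ex_series (fun k => Rabs (u k * x ^ k))).
  { apply (@ex_series_le R_AbsRing R_CompleteNormedModule _ (fun k => Rabs (u k) * r ^ k)); [|exact Hex]. intros k. unfold norm; simpl; unfold abs; simpl.
    rewrite Rabs_Rabsolu. apply Hle. }
  assert (Hexx : ex_series (fun k => u k * x ^ k)) by now apply ex_series_Rabs.
  unfold PSeries.
  rewrite (Series_incr_n _ (S K) (Nat.lt_0_succ K) Hexx).
  rewrite (Series_incr_n _ (S K) (Nat.lt_0_succ K) Hex).
  simpl Init.Nat.pred. rewrite !sum_n_Reals.
  match goal with |- Rabs (?s - (?s + ?t)) <= ?p + ?q - ?p =>
    replace (s - (s + t)) with (- t) by ring; replace (p + q - p) with q by ring end.
  rewrite Rabs_Ropp.
  apply Rle_trans with (Series (fun k => Rabs (u (S K + k)%nat * x ^ (S K + k)))).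
  - apply Series_Rabs. apply (ex_series_incr_n (fun k => Rabs (u k * x ^ k)) (S K)), HexA.
  - apply Series_le.
    + intros k; split; [apply Rabs_pos|apply Hle].
    + apply (ex_series_incr_n (fun k => Rabs (u k) * r ^ k) (S K)), Hex.
Qed.

Lemma is_RInt_sum_n_moment (u : nat -> R) (n : Z) (r : R) (K : nat) :
  is_RInt (fun t => sum_n (fun k => u k * (r * cos t) ^ k) K * cos (IZR n * t)) 0 PI
    (sum_n (fun k => u k * cos_moment k n * r ^ k) K).
Proof.
  assert (H1 : forall k, is_RInt (fun t => u k * (r * cos t) ^ k * cos (IZR n * t)) 0 PI
    (u k * cos_moment k n * r ^ k)).
  { intros k. evar_last.
    - apply is_RInt_ext with (fun t => scal (u k * r ^ k) (cos t ^ k * cos (IZR n * t))).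
      + intros t _. unfold scal; simpl; unfold mult; simpl. rewrite Rpow_mult_distr. ring.
      + apply (is_RInt_scal (fun t => cos t ^ k * cos (IZR n * t))), is_RInt_cos_moment.
    - unfold scal; simpl; unfold mult; simpl. ring. }
  induction K as [|K IH].
  - rewrite sum_O. apply is_RInt_ext with (2 := H1 0%nat). intros t _. now rewrite sum_O.
  - rewrite sum_Sn. apply is_RInt_ext with (fun t =>
      plus (sum_n (fun k => u k * (r * cos t) ^ k) K * cos (IZR n * t))
           (u (S K) * (r * cos t) ^ S K * cos (IZR n * t))).
    + intros t _. rewrite sum_Sn. unfold plus; simpl. ring.
    + apply (is_RInt_plus
        (fun t => sum_n (fun k => u k * (r * cos t) ^ k) K * cos (IZR n * t))
        (fun t => u (S K) * (r * cos t) ^ S K * cos (IZR n * t))); [apply IH|apply H1].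
Qed.

Lemma is_RInt_hs_cos (al : R) (n : Z) (r : R) : 0 <= r < 1 ->
  let N := Z.abs_nat n in
  is_RInt (fun t => hs al 1 0 (r * cos t) * cos (IZR n * t)) 0 PI
    (r ^ N * (PI / 2 ^ N * poch al N *
      hs ((al + INR N + 1) / 2) ((al + INR N) / 2) N (r ^ 2))).
Proof.
  intros Hr N. set (u := hcoef al 1 0).
  assert (Hex : ex_series (fun k => Rabs (u k) * r ^ k)).
  { apply ex_series_ext with (fun k => Rabs (u k * r ^ k)).
    - intros k. rewrite Rabs_mult. f_equal. apply Rabs_pos_eq, pow_le; lra.
    - apply CV_disk_inside, hcoef_radius. rewrite Rabs_pos_eq; lra. }
  destruct (filterlim_RInt
    (fun K t => sum_n (fun k => u k * (r * cos t) ^ k) K * cos (IZR n * t)) 0 PI eventually _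
    (fun t => hs al 1 0 (r * cos t) * cos (IZR n * t))
    (fun K => sum_n (fun k => u k * cos_moment k n * r ^ k) K)) as [l [Hl HI]].
  - intros K. apply is_RInt_sum_n_moment.
  - apply filterlim_locally. intros eps.
    assert (HS := Series_correct _ Hex).
    apply (proj1 (filterlim_locally (sum_n (fun k => Rabs (u k) * r ^ k)) _)) with (eps := eps) in HS.
    revert HS. apply filter_imp. intros K HK t.
    change (Rabs (sum_n (fun k => Rabs (u k) * r ^ k) K - Series (fun k => Rabs (u k) * r ^ k))
      < eps) in HK.
    change (Rabs (sum_n (fun k => u k * (r * cos t) ^ k) K * cos (IZR n * t)
      - PSeries u (r * cos t) * cos (IZR n * t)) < eps).
    rewrite <- Rmult_minus_distr_r, Rabs_mult.
    assert (Hc : Rabs (r * cos t) <= r).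
    { rewrite Rabs_mult, (Rabs_pos_eq r) by lra.
      rewrite <- (Rmult_1_r r) at 2. apply Rmult_le_compat_l; [lra|].
      apply Rabs_le. apply COS_bound. }
    pose proof (sum_n_tail_bound u r (r * cos t) K Hex Hc) as HB.
    assert (Rabs (cos (IZR n * t)) <= 1) by (apply Rabs_le, COS_bound).
    apply Rabs_def2 in HK.
    set (A := Rabs (sum_n _ _ - _)) in *.
    assert (0 <= A) by apply Rabs_pos.
    pose proof (Rabs_pos (cos (IZR n * t))). nra.
  - replace (r ^ N * _) with l; [exact HI|].
    assert (Hser : is_series (fun k => u k * cos_moment k n * r ^ k) l) by exact Hl.
    apply is_series_unique in Hser. rewrite <- Hser.
    assert (Hmom : forall k, cos_moment k n = cos_moment k (Z.of_nat N)).
    { intros k. destruct (Z_le_dec 0 n).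
      - f_equal. unfold N; lia.
      - rewrite <- cos_moment_opp. f_equal. unfold N; lia. }
    rewrite (Series_incr_n_aux _ N).
    + transitivity (Series (fun j => r ^ N * ((u (N + j)%nat * cos_moment (N + j) n) * r ^ j))).
      { apply Series_ext. intros j. rewrite pow_add. ring. }
      rewrite Series_scal_l. f_equal.
      change (PSeries (fun j => u (N + j)%nat * cos_moment (N + j) n) r = PI / 2 ^ N * poch al N *
        hs ((al + INR N + 1) / 2) ((al + INR N) / 2) N (r ^ 2)).
      apply is_pseries_unique.
      evar_last.
      (* After removal of r^N only even offsets survive, giving a series in r^2. Odd offsets vanish
         by parity, since |n| + n = 2 max(n, 0). *)
      * apply is_pseries_odd_even with (l2 := 0).
        -- apply is_pseries_ext with (PS_scal (PI / 2 ^ N * poch al N)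
             (hcoef ((al + INR N + 1) / 2) ((al + INR N) / 2) N)).
           ++ intros i. rewrite Hmom. unfold u. rewrite hs_duplication_coef. reflexivity.
           ++ apply is_pseries_scal; [apply Rmult_comm|].
              apply PSeries_correct, CV_radius_inside, hcoef_radius.
              rewrite Rabs_pos_eq; nra.
        -- apply is_pseries_ext with (fun _ => 0).
           ++ intros i. rewrite cos_moment_odd; [symmetry; apply Rmult_0_r|].
              replace (Z.of_nat (N + (2 * i + 1)) + n)%Z
                with (1 + 2 * (Z.of_nat i + Z.max n 0))%Z by (unfold N; lia).
              now rewrite Z.odd_add_mul_2.
           ++ assert (H0 : is_pseries (fun _ => 0) (r ^ 2) (PSeries (fun _ => 0) (r ^ 2)))
                by (apply PSeries_correct, CV_radius_inside; now rewrite CV_radius_const_0).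
              now rewrite PSeries_const_0 in H0.
      * unfold scal; simpl; unfold mult; simpl. fold (hs ((al + INR N + 1) / 2) ((al + INR N) / 2) N (r * (r * 1))). ring.
    + intros k Hk. rewrite Hmom, cos_moment_large by lia. ring.
Qed.

Lemma heine_integral (al : R) (n : Z) (z : R) : 1 < z ->
  let N := Z.abs_nat n in
  is_RInt (fun t => Rpower (z - cos t) (- al) * cos (IZR n * t)) 0 PI
    (PI * poch al N / (2 ^ N * Rpower z (al + INR N)) *
      hs ((al + INR N + 1) / 2) ((al + INR N) / 2) N (1 / z ^ 2)).
Proof.
  intros Hz N.
  assert (Hr : 0 <= / z < 1).
  { split; [left; apply Rinv_0_lt_compat; lra|].
    rewrite <- Rinv_1. apply Rinv_lt_contravar; lra. }
  evar_last.
  - apply is_RInt_ext with (fun t => scal (Rpower z (- al))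
      (hs al 1 0 (/ z * cos t) * cos (IZR n * t))).
    + intros t _. unfold scal; simpl; unfold mult; simpl.
      pose proof (COS_bound t).
      rewrite binomial_series.
      * rewrite <- Rmult_assoc, Rpower_mult_distr; [|lra|].
        -- f_equal. f_equal. field. lra.
        -- assert (/ z * cos t <= / z) by nra. lra.
      * apply Rabs_def1; nra.
    + apply (is_RInt_scal (fun t => hs al 1 0 (/ z * cos t) * cos (IZR n * t))).
      now apply is_RInt_hs_cos.
  - unfold scal; simpl; unfold mult; simpl. fold N.
    replace (z * (z * 1)) with (z ^ 2) by ring.
    replace (/ z * (/ z * 1)) with (1 / z ^ 2) by (field; lra).
    rewrite Rpower_plus, Rpower_Ropp, Rpower_pow, pow_inv by lra.
    field. repeat split; try (apply pow_nonzero; lra). apply Rgt_not_eq, exp_pos.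
Qed.

(** Splitting Gamma(M+N+1/2) as [poch al N * Gamma al] leaves a prefactor free of [n], so all
    dependence on [n] sits in the integral. *)
Lemma legQ_heine (M : nat) (n : Z) (z S : R) : 1 < z ->
  let al := INR M + 1 / 2 in
  legQ (Z.of_nat M) (Z.abs_nat n) z S =
  (-1) ^ M * sqrt PI * Gamma al * S ^ M / (PI * Rpower 2 (1 / 2)) *
  RInt (fun t => Rpower (z - cos t) (- al) * cos (IZR n * t)) 0 PI.
Proof.
  intros Hz al. rewrite (is_RInt_unique _ _ _ _ (heine_integral al n z Hz)).
  unfold legQ. set (N := Z.abs_nat n).
  rewrite plus_IZR, <- !INR_IZR_INZ, <- !pow_powerRZ.
  replace (INR M + INR N + 1 / 2) with (IZR (Z.of_nat M) + 1 / 2 + INR N)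
    by (rewrite <- INR_IZR_INZ; ring).
  rewrite Gamma_half_poch, <- INR_IZR_INZ. fold al.
  replace ((INR N + INR M) / 2 + 3 / 4) with ((al + INR N + 1) / 2) by (unfold al; field).
  replace ((INR N + INR M) / 2 + 1 / 4) with ((al + INR N) / 2) by (unfold al; field).
  replace (INR N + INR M + 1 / 2) with (al + INR N) by (unfold al; ring).
  rewrite (Rpower_plus (INR N)), Rpower_pow by lra.
  field. repeat split; try (apply pow_nonzero; lra); try (apply Rgt_not_eq, exp_pos).
  apply PI_neq0.
Qed.

(** * Two-variable continuity *)

Lemma continuity_2d_pt_pow (f : R -> R -> R) k x y :
  continuity_2d_pt f x y -> continuity_2d_pt (fun u v => f u v ^ k) x y.
Proof.
  intros Hf. induction k as [|k IH]; simpl; [apply continuity_2d_pt_const|].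
  now apply continuity_2d_pt_mult.
Qed.

Lemma continuity_2d_pt_comp_continuous (g : R -> R) (f : R -> R -> R) x y :
  continuous g (f x y) -> continuity_2d_pt f x y ->
  continuity_2d_pt (fun u v => g (f u v)) x y.
Proof.
  intros Hg Hf. apply continuity_1d_2d_pt_comp; [|exact Hf].
  now apply continuity_pt_filterlim.
Qed.

Lemma continuity_2d_pt_snd (f : R -> R -> R) x y :
  continuity_2d_pt f x y -> continuous (f x) y.
Proof.
  intros Hf. apply continuity_pt_filterlim. intros eps Heps.
  destruct (Hf (mkposreal eps Heps)) as [d Hd].
  exists d; split; [apply cond_pos|]. intros t [_ Ht].
  apply Hd; [|exact Ht]. rewrite Rminus_diag, Rabs_R0. apply cond_pos.
Qed.

(** The partial derivative is given by a formula instead of [Derive]: continuity can be checked on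
    it, and the lemma can be applied again to the derivative. *)
Lemma is_derive_RInt_param_explicit (F F1 : R -> R -> R) (a b z0 : R) : a <= b ->
  locally z0 (fun z => forall t, a <= t <= b -> continuity_2d_pt F z t) ->
  locally z0 (fun z => forall t, a <= t <= b -> is_derive (fun u => F u t) z (F1 z t)) ->
  (forall t, a <= t <= b ->
    locally_2d (fun z t => is_derive (fun u => F u t) z (F1 z t)) z0 t) ->
  (forall t, a <= t <= b -> continuity_2d_pt F1 z0 t) ->
  is_derive (fun z => RInt (F z) a b) z0 (RInt (F1 z0) a b).
Proof.
  intros Hab HF Hd Hd2 Hc.
  assert (Hd0 := locally_singleton _ _ Hd).
  evar_last.
  - apply (is_derive_RInt_param F a b z0); rewrite ?Rmin_left, ?Rmax_right by easy.
    + revert Hd; apply filter_imp. intros z Hz t Ht. eexists. now apply Hz.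
    + intros t Ht. apply continuity_2d_pt_ext_loc with F1; [|now apply Hc].
      apply locally_2d_impl with (2 := Hd2 t Ht). apply locally_2d_forall.
      intros u v H. symmetry. now apply is_derive_unique.
    + revert HF; apply filter_imp. intros z Hz.
      apply (ex_RInt_continuous (F z)). rewrite Rmin_left, Rmax_right by easy.
      intros t Ht. now apply continuity_2d_pt_snd, Hz.
  - apply RInt_ext. rewrite Rmin_left, Rmax_right by easy.
    intros t Ht. apply is_derive_unique, Hd0. lra.
Qed.

(** * The kernel *)

Definition kerD (c z t : R) : R := c * z - cos t.

(** This is 1/chi^2, because chi = [kerD] / (sinh s sinh s'). *)
Definition kerR (c z t : R) : R := (c ^ 2 - 1) * (z ^ 2 - 1) / kerD c z t ^ 2.

Definition ker_al (M : nat) : R := INR M + 1 / 2.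

Definition ker_hs (M : nat) : R -> R := hs ((ker_al M + 1) / 2) (ker_al M / 2) M.
Definition ker_hs1 (M : nat) : R -> R := hs1 ((ker_al M + 1) / 2) (ker_al M / 2) M.
Definition ker_hs2 (M : nat) : R -> R := hs2 ((ker_al M + 1) / 2) (ker_al M / 2) M.

(** The absolute value matters: derivatives at z = 1 are two-sided, and [kerR] is negative for z
    slightly below 1 when c > 1. *)
Definition ker_dom (c z t : R) : Prop := 0 < kerD c z t /\ Rabs (kerR c z t) < 1.

Definition kerR_z (c z t : R) : R :=
  (c ^ 2 - 1) * (2 * z / kerD c z t ^ 2 - 2 * (z ^ 2 - 1) * c / kerD c z t ^ 3).

Definition kerR_zz (c z t : R) : R :=
  (c ^ 2 - 1) * (2 / kerD c z t ^ 2 - 8 * z * c / kerD c z t ^ 3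
    + 6 * (z ^ 2 - 1) * c ^ 2 / kerD c z t ^ 4).

Definition ker (M : nat) (c z t : R) : R :=
  Rpower (kerD c z t) (- ker_al M) * ker_hs M (kerR c z t).

Definition ker_z (M : nat) (c z t : R) : R :=
  Rpower (kerD c z t) (- ker_al M) *
  (- ker_al M * c / kerD c z t * ker_hs M (kerR c z t)
   + kerR_z c z t * ker_hs1 M (kerR c z t)).

Definition ker_zz (M : nat) (c z t : R) : R :=
  Rpower (kerD c z t) (- ker_al M) *
  ((ker_al M ^ 2 + ker_al M) * c ^ 2 / kerD c z t ^ 2 * ker_hs M (kerR c z t)
   + (kerR_zz c z t - 2 * ker_al M * c / kerD c z t * kerR_z c z t) * ker_hs1 M (kerR c z t)
   + kerR_z c z t ^ 2 * ker_hs2 M (kerR c z t)).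

Definition kerR_t (c z t : R) : R :=
  - 2 * (c ^ 2 - 1) * (z ^ 2 - 1) * sin t / kerD c z t ^ 3.

Definition ker_t (M : nat) (c z t : R) : R :=
  Rpower (kerD c z t) (- ker_al M) *
  (- ker_al M * sin t / kerD c z t * ker_hs M (kerR c z t)
   + kerR_t c z t * ker_hs1 M (kerR c z t)).

(* [sin t ^ 2] is written [1 - cos t ^ 2] so that [ker_pde] is a rational identity
   in [cos t]. *)
Definition ker_tt (M : nat) (c z t : R) : R :=
  let P := (c ^ 2 - 1) * (z ^ 2 - 1) in
  Rpower (kerD c z t) (- ker_al M) *
  (((ker_al M ^ 2 + ker_al M) * (1 - cos t ^ 2) / kerD c z t ^ 2
     - ker_al M * cos t / kerD c z t) * ker_hs M (kerR c z t)
   + ((4 * ker_al M + 6) * P * (1 - cos t ^ 2) / kerD c z t ^ 4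
       - 2 * P * cos t / kerD c z t ^ 3) * ker_hs1 M (kerR c z t)
   + 4 * P ^ 2 * (1 - cos t ^ 2) / kerD c z t ^ 6 * ker_hs2 M (kerR c z t)).

Lemma is_derive_kerD_power_z al c z t : 0 < kerD c z t ->
  is_derive (fun z => Rpower (kerD c z t) (- al)) z
    (Rpower (kerD c z t) (- al) * (- al * c / kerD c z t)).
Proof.
  intros HD. unfold kerD, Rpower in *. auto_derive; [lra|].
  change (c * z + - cos t) with (c * z - cos t). field. lra.
Qed.

Lemma is_derive_kerD_power_t al c z t : 0 < kerD c z t ->
  is_derive (fun t => Rpower (kerD c z t) (- al)) t
    (Rpower (kerD c z t) (- al) * (- al * sin t / kerD c z t)).
Proof.
  intros HD. unfold kerD, Rpower in *. auto_derive; [lra|].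
  change (c * z + - cos t) with (c * z - cos t). field. lra.
Qed.

Lemma is_derive_kerR_z c z t : 0 < kerD c z t ->
  is_derive (fun z => kerR c z t) z (kerR_z c z t).
Proof.
  intros HD. unfold kerR, kerR_z, kerD in *. auto_derive.
  - repeat split. apply Rgt_not_eq. nra.
  - field. lra.
Qed.

Lemma is_derive_kerR_zz c z t : 0 < kerD c z t ->
  is_derive (fun z => kerR_z c z t) z (kerR_zz c z t).
Proof.
  intros HD. unfold kerR_z, kerR_zz, kerD in *.
  assert (c * z + - cos t <> 0) by lra.
  auto_derive.
  - repeat split; repeat apply Rmult_integral_contrapositive_currified; lra.
  - field. lra.
Qed.

Lemma is_derive_kerR_t c z t : 0 < kerD c z t ->
  is_derive (fun t => kerR c z t) t (kerR_t c z t).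
Proof.
  intros HD. unfold kerR, kerR_t, kerD in *. auto_derive.
  - repeat split. apply Rgt_not_eq. nra.
  - field. lra.
Qed.

Lemma is_derive_ker_z M c z t : ker_dom c z t ->
  is_derive (fun z => ker M c z t) z (ker_z M c z t).
Proof.
  intros [HD HR]. unfold ker, ker_z. evar_last.
  - apply is_derive_mult_R; [now apply is_derive_kerD_power_z|].
    apply (is_derive_comp_R (ker_hs M) (fun z => kerR c z t));
      [now apply is_derive_hs|now apply is_derive_kerR_z].
  - simpl. unfold ker_hs1. field. lra.
Qed.

Lemma is_derive_ker_zz M c z t : ker_dom c z t ->
  is_derive (fun z => ker_z M c z t) z (ker_zz M c z t).
Proof.
  intros [HD HR]. unfold ker_z, ker_zz. evar_last.
  - apply is_derive_mult_R; [now apply is_derive_kerD_power_z|].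
    apply (is_derive_plus
      (fun z => - ker_al M * c / kerD c z t * ker_hs M (kerR c z t))
      (fun z => kerR_z c z t * ker_hs1 M (kerR c z t))).
    + apply is_derive_mult_R.
      * instantiate (1 := ker_al M * c ^ 2 / kerD c z t ^ 2).
        unfold kerD in *. auto_derive; [lra|field; lra].
      * apply (is_derive_comp_R (ker_hs M) (fun z => kerR c z t));
          [now apply is_derive_hs|now apply is_derive_kerR_z].
    + apply is_derive_mult_R; [now apply is_derive_kerR_zz|].
      apply (is_derive_comp_R (ker_hs1 M) (fun z => kerR c z t));
        [now apply is_derive_hs1|now apply is_derive_kerR_z].
  - unfold plus; simpl. fold (ker_hs1 M (kerR c z t)). fold (ker_hs2 M (kerR c z t)).
    field. lra.
Qed.

Lemma is_derive_ker_t M c z t : ker_dom c z t ->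
  is_derive (fun t => ker M c z t) t (ker_t M c z t).
Proof.
  intros [HD HR]. unfold ker, ker_t. evar_last.
  - apply is_derive_mult_R; [now apply is_derive_kerD_power_t|].
    apply (is_derive_comp_R (ker_hs M) (fun t => kerR c z t));
      [now apply is_derive_hs|now apply is_derive_kerR_t].
  - simpl. unfold ker_hs1. field. lra.
Qed.

Lemma is_derive_ker_tt M c z t : ker_dom c z t ->
  is_derive (fun t => ker_t M c z t) t (ker_tt M c z t).
Proof.
  intros [HD HR]. unfold ker_t, ker_tt. cbv zeta.
  assert (Hs : 1 - cos t ^ 2 = sin t ^ 2)
    by (pose proof (sin2_cos2 t); unfold Rsqr in *; simpl; lra).
  rewrite !Hs. evar_last.
  - apply is_derive_mult_R; [now apply is_derive_kerD_power_t|].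
    apply (is_derive_plus
      (fun t => - ker_al M * sin t / kerD c z t * ker_hs M (kerR c z t))
      (fun t => kerR_t c z t * ker_hs1 M (kerR c z t))).
    + apply is_derive_mult_R.
      * instantiate (1 := ker_al M * sin t ^ 2 / kerD c z t ^ 2
          - ker_al M * cos t / kerD c z t).
        unfold kerD in *. auto_derive; [lra|field; lra].
      * apply (is_derive_comp_R (ker_hs M) (fun t => kerR c z t));
          [now apply is_derive_hs|now apply is_derive_kerR_t].
    + apply is_derive_mult_R.
      * instantiate (1 := (c ^ 2 - 1) * (z ^ 2 - 1) *
          (6 * sin t ^ 2 / kerD c z t ^ 4 - 2 * cos t / kerD c z t ^ 3)).
        unfold kerR_t, kerD in *.
        assert (c * z + - cos t <> 0) by lra.
        auto_derive; [|field; lra].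
        repeat split; repeat apply Rmult_integral_contrapositive_currified; lra.
      * apply (is_derive_comp_R (ker_hs1 M) (fun t => kerR c z t));
        [now apply is_derive_hs1|now apply is_derive_kerR_t].
  - unfold plus; simpl. fold (ker_hs1 M (kerR c z t)). fold (ker_hs2 M (kerR c z t)).
    unfold kerR_t. field. lra.
Qed.

(* The left-hand side is the hypergeometric equation at [r = kerR c z t] multiplied by
   [((z^2 - 1) r_z^2 + r_t^2) / (r (1 - r)) = 4 (c^2 - 1) / D^2]. *)
Lemma ker_pde M c z t : ker_dom c z t ->
  (z ^ 2 - 1) * ker_zz M c z t + (2 * INR M + 2) * z * ker_z M c z t
    + ker_al M ^ 2 * ker M c z t + ker_tt M c z t = 0.
Proof.
  intros [HD HR]. unfold ker, ker_z, ker_zz, ker_tt. cbv zeta.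
  pose proof (hs_ode ((ker_al M + 1) / 2) (ker_al M / 2) M (kerR c z t) HR) as H.
  fold (ker_hs M (kerR c z t)) in H. fold (ker_hs1 M (kerR c z t)) in H.
  fold (ker_hs2 M (kerR c z t)) in H.
  set (f := ker_hs M _) in *. set (f1 := ker_hs1 M _) in *. set (f2 := ker_hs2 M _) in *.
  set (E := Rpower _ _).
  match type of H with ?L = 0 =>
    transitivity (E * (4 * (c ^ 2 - 1) / kerD c z t ^ 2) * L); [|rewrite H; ring] end.
  unfold kerR, kerR_z, kerR_zz, ker_al, kerD in *. field. lra.
Qed.

(** * Joint continuity of the kernel and its derivatives *)

Ltac cont2d :=
  repeat first
    [ apply continuity_2d_pt_const | apply continuity_2d_pt_id1 | apply continuity_2d_pt_id2
    | apply continuity_2d_pt_plus | apply continuity_2d_pt_minus | apply continuity_2d_pt_mult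
    | apply continuity_2d_pt_opp | apply continuity_2d_pt_pow ].

Lemma continuity_2d_pt_cos c x y : continuity_2d_pt (fun _ v => cos (c * v)) x y.
Proof.
  apply (continuity_2d_pt_comp_continuous cos (fun _ v => c * v)); [apply continuous_cos|].
  cont2d.
Qed.

Lemma continuity_2d_pt_cos1 x y : continuity_2d_pt (fun _ v => cos v) x y.
Proof.
  apply (continuity_2d_pt_comp_continuous cos (fun _ v => v)); [apply continuous_cos|].
  cont2d.
Qed.

Lemma continuity_2d_kerD c x y : continuity_2d_pt (kerD c) x y.
Proof. unfold kerD. cont2d. apply continuity_2d_pt_cos1. Qed.

Lemma continuity_2d_inv_kerD c k x y : 0 < kerD c x y ->
  continuity_2d_pt (fun u v => / kerD c u v ^ k) x y.
Proof.
  intros H. apply continuity_2d_pt_inv; [|apply pow_nonzero; lra].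
  apply continuity_2d_pt_pow, continuity_2d_kerD.
Qed.

Lemma continuity_2d_inv_kerD1 c x y : 0 < kerD c x y ->
  continuity_2d_pt (fun u v => / kerD c u v) x y.
Proof. intros H. apply continuity_2d_pt_inv; [|lra]. apply continuity_2d_kerD. Qed.

Lemma continuity_2d_kerR c x y : 0 < kerD c x y -> continuity_2d_pt (kerR c) x y.
Proof. intros H. unfold kerR, Rdiv. cont2d. now apply continuity_2d_inv_kerD. Qed.

Lemma continuity_2d_kerD_power al c x y : 0 < kerD c x y ->
  continuity_2d_pt (fun u v => Rpower (kerD c u v) (- al)) x y.
Proof.
  intros H. apply (continuity_2d_pt_comp_continuous (fun w => Rpower w (- al)) (kerD c)).
  - now apply continuous_Rpower.
  - apply continuity_2d_kerD.
Qed.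

Lemma continuity_2d_ker_hs M c x y : ker_dom c x y ->
  continuity_2d_pt (fun u v => ker_hs M (kerR c u v)) x y.
Proof.
  intros [HD HR]. apply (continuity_2d_pt_comp_continuous (ker_hs M) (kerR c)).
  - now apply continuous_hs.
  - now apply continuity_2d_kerR.
Qed.

Lemma continuity_2d_ker_hs1 M c x y : ker_dom c x y ->
  continuity_2d_pt (fun u v => ker_hs1 M (kerR c u v)) x y.
Proof.
  intros [HD HR]. apply (continuity_2d_pt_comp_continuous (ker_hs1 M) (kerR c)).
  - now apply continuous_hs1.
  - now apply continuity_2d_kerR.
Qed.

Lemma continuity_2d_ker_hs2 M c x y : ker_dom c x y ->
  continuity_2d_pt (fun u v => ker_hs2 M (kerR c u v)) x y.
Proof.
  intros [HD HR]. apply (continuity_2d_pt_comp_continuous (ker_hs2 M) (kerR c)).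
  - now apply continuous_hs2.
  - now apply continuity_2d_kerR.
Qed.

Ltac cont2d_ker H :=
  unfold Rdiv;
  repeat lazymatch goal with
  | |- continuity_2d_pt (fun u v => @?f u v + @?g u v) _ _ => apply (continuity_2d_pt_plus f g)
  | |- continuity_2d_pt (fun u v => @?f u v - @?g u v) _ _ => apply (continuity_2d_pt_minus f g)
  | |- continuity_2d_pt (fun u v => @?f u v * @?g u v) _ _ => apply (continuity_2d_pt_mult f g)
  | |- continuity_2d_pt (fun u v => Rpower (kerD _ u v) _) _ _ =>
      apply continuity_2d_kerD_power; exact (proj1 H)
  | |- continuity_2d_pt (fun u v => ker_hs _ _) _ _ => apply continuity_2d_ker_hs; exact H
  | |- continuity_2d_pt (fun u v => ker_hs1 _ _) _ _ => apply continuity_2d_ker_hs1; exact H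
  | |- continuity_2d_pt (fun u v => ker_hs2 _ _) _ _ => apply continuity_2d_ker_hs2; exact H
  | |- continuity_2d_pt (fun u v => / (kerD _ _ _ ^ _)) _ _ =>
      apply continuity_2d_inv_kerD; exact (proj1 H)
  | |- continuity_2d_pt (fun u v => / kerD _ _ _) _ _ =>
      apply continuity_2d_inv_kerD1; exact (proj1 H)
  | |- continuity_2d_pt (fun u v => @?f u v ^ ?k) _ _ => apply (continuity_2d_pt_pow f k)
  | |- continuity_2d_pt (fun u v => cos v) _ _ => apply continuity_2d_pt_cos1
  | |- continuity_2d_pt (fun u v => u) _ _ => apply continuity_2d_pt_id1
  | |- continuity_2d_pt (fun u v => ?c) _ _ => apply continuity_2d_pt_const
  end.

Lemma continuity_2d_ker M c x y : ker_dom c x y -> continuity_2d_pt (ker M c) x y.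
Proof. intros H. unfold ker. cont2d_ker H. Qed.

Lemma continuity_2d_ker_z M c x y : ker_dom c x y -> continuity_2d_pt (ker_z M c) x y.
Proof. intros H. unfold ker_z, kerR_z. cont2d_ker H. Qed.

Lemma continuity_2d_ker_zz M c x y : ker_dom c x y -> continuity_2d_pt (ker_zz M c) x y.
Proof. intros H. unfold ker_zz, kerR_z, kerR_zz. cont2d_ker H. Qed.

Lemma continuity_2d_ker_tt M c x y : ker_dom c x y -> continuity_2d_pt (ker_tt M c) x y.
Proof. intros H. unfold ker_tt. cbv zeta. cont2d_ker H. Qed.

Lemma ker_dom_open c x y : ker_dom c x y -> locally_2d (ker_dom c) x y.
Proof.
  intros [HD HR].
  assert (H1 := continuity_2d_kerD c x y (mkposreal _ HD)).
  assert (HR' : 0 < 1 - Rabs (kerR c x y)) by lra.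
  assert (H2 := continuity_2d_kerR c x y HD (mkposreal _ HR')).
  simpl in H1, H2.
  apply locally_2d_impl with (2 := H1). apply locally_2d_impl with (2 := H2).
  apply locally_2d_forall. intros u v Hu2 Hu1. split.
  - apply Rabs_def2 in Hu1. lra.
  - replace (kerR c u v) with (kerR c u v - kerR c x y + kerR c x y) by ring.
    eapply Rle_lt_trans; [apply Rabs_triang|]. lra.
Qed.

(** * The region where the kernel is regular *)

Lemma cos_lt_1 t : 0 < t <= PI -> cos t < 1.
Proof.
  intros Ht. rewrite <- cos_0. pose proof PI_RGT_0. apply cos_decreasing_1; lra.
Qed.

Definition ker_gap (c z t : R) : R := kerD c z t ^ 2 - (c ^ 2 - 1) * (z ^ 2 - 1).

(** Separates the distance from the diagonal z = c from the angle. If c z > 1, both terms are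
    non-negative and vanish together only at z = c, cos t = 1, the one singular point; the angular
    term alone gives the bound that is uniform in z. *)
Lemma ker_gap_eq c z t :
  ker_gap c z t = (c - z) ^ 2 + (1 - cos t) * (2 * (c * z) - 1 - cos t).
Proof. unfold ker_gap, kerD. ring. Qed.

Lemma ker_gap_pos c z t : 0 < c * z - 1 -> (z < c \/ cos t < 1) -> 0 < ker_gap c z t.
Proof.
  intros Hcz Hor. pose proof (COS_bound t). rewrite ker_gap_eq.
  destruct Hor as [Hu3|Hu3].
  - assert (0 < (c - z) ^ 2) by (apply pow_lt; lra).
    assert (0 <= (1 - cos t) * (2 * (c * z) - 1 - cos t)) by (apply Rmult_le_pos; lra). lra.
  - pose proof (pow2_ge_0 (c - z)).
    assert (0 < (1 - cos t) * (2 * (c * z) - 1 - cos t)) by (apply Rmult_lt_0_compat; lra).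
    lra.
Qed.

Lemma one_minus_kerR c z t : 0 < kerD c z t ->
  1 - kerR c z t = ker_gap c z t / kerD c z t ^ 2.
Proof. intros H. unfold kerR, ker_gap. field. lra. Qed.

(** The second hypothesis gives [kerR > -1] when z < 1. Both polynomial conditions are open and hold
    at z = 1 for c > 1, so they cover a whole neighbourhood. *)
Lemma ker_domI c z t : 0 < c * z - 1 ->
  0 < (c * z - 1) ^ 2 - (c ^ 2 - 1) * (1 - z ^ 2) ->
  (z < c \/ cos t < 1) -> ker_dom c z t.
Proof.
  intros Hz1 Hz2 Hor.
  pose proof (COS_bound t) as Hcos.
  assert (HD : 0 < kerD c z t) by (unfold kerD; lra).
  split; [exact HD|].
  assert (HD2 : 0 < kerD c z t ^ 2) by now apply pow_lt.
  assert (Hle : kerD c z t ^ 2 >= (c * z - 1) ^ 2) by (unfold kerD; nra).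
  pose proof (ker_gap_pos c z t Hz1 Hor) as Hgap.
  apply Rabs_def1.
  - assert (0 < 1 - kerR c z t); [|lra].
    rewrite one_minus_kerR by easy. now apply Rdiv_lt_0_compat.
  - unfold kerR. apply Rmult_lt_reg_r with (kerD c z t ^ 2); [easy|].
    unfold Rdiv; rewrite Rmult_assoc, Rinv_l; lra.
Qed.

Lemma ker_dom_ge_1 c z t : 1 < c -> 1 <= z -> (z < c \/ cos t < 1) -> ker_dom c z t.
Proof.
  intros Hc Hz Hor. apply ker_domI; [nra| |easy].
  assert (0 < (c * z - 1) ^ 2) by (apply pow_lt; nra).
  assert (0 <= (c ^ 2 - 1) * (z ^ 2 - 1)) by (apply Rmult_le_pos; nra). nra.
Qed.

(** [e] is a cut-off at the singular endpoint: for z < c it may be 0, while a positive [e] admits z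
    = c. *)
Definition ker_ok (c e z : R) : Prop := forall t, e <= t <= PI -> ker_dom c z t.

Lemma ker_ok_locally c e z : 1 < c -> 0 <= e -> 1 <= z -> (z < c \/ 0 < e) ->
  locally z (ker_ok c e).
Proof.
  intros Hc He Hz Hor.
  assert (Hopen : forall f : R -> R, continuous f z -> 0 < f z -> locally z (fun u => 0 < f u)).
  { intros f Hf H0. apply Hf. exists (mkposreal _ H0). intros u Hu.
    change (Rabs (u - f z) < f z) in Hu. apply Rabs_def2 in Hu. lra. }
  assert (H1 : locally z (fun u => 0 < c * u - 1)).
  { apply (Hopen (fun u => c * u - 1)); [|nra].
    apply (ex_derive_continuous (fun u => c * u - 1)). auto_derive; auto. }
  assert (H2 : locally z (fun u => 0 < (c * u - 1) ^ 2 - (c ^ 2 - 1) * (1 - u ^ 2))).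
  { apply (Hopen (fun u => (c * u - 1) ^ 2 - (c ^ 2 - 1) * (1 - u ^ 2))).
    - apply (ex_derive_continuous (fun u => (c * u - 1) ^ 2 - (c ^ 2 - 1) * (1 - u ^ 2))).
      auto_derive; auto.
    - assert (0 < (c * z - 1) ^ 2) by (apply pow_lt; nra).
      assert (0 <= (c ^ 2 - 1) * (z ^ 2 - 1)) by (apply Rmult_le_pos; nra). nra. }
  assert (H3 : locally z (fun u => u < c \/ 0 < e)).
  { destruct Hor as [Hzc|He0]; [|apply filter_forall; now right].
    assert (H3 : locally z (fun u => 0 < c - u)).
    { apply (Hopen (fun u => c - u)); [|lra].
      apply (ex_derive_continuous (fun u => c - u)). auto_derive; auto. }
    revert H3; apply filter_imp. intros u Hu; left; lra. }
  generalize (filter_and _ _ H1 (filter_and _ _ H2 H3)). apply filter_imp.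
  intros u [Hu1 [Hu2 Hu3]] t Ht. apply ker_domI; [easy..|].
  destruct Hu3 as [Hu3|Hu3]; [now left|right]. apply cos_lt_1; lra.
Qed.

Lemma ker_ok_here c e z : 1 < c -> 0 <= e -> 1 <= z -> (z < c \/ 0 < e) -> ker_ok c e z.
Proof. intros. now apply (locally_singleton z (ker_ok c e)), ker_ok_locally. Qed.

(** * The cosine coefficient of the kernel and its differential equation *)

Definition kernel_int (M : nat) (n : Z) (c e z : R) : R :=
  RInt (fun t => ker M c z t * cos (IZR n * t)) e PI.
Definition kernel_int1 (M : nat) (n : Z) (c e z : R) : R :=
  RInt (fun t => ker_z M c z t * cos (IZR n * t)) e PI.
Definition kernel_int2 (M : nat) (n : Z) (c e z : R) : R :=
  RInt (fun t => ker_zz M c z t * cos (IZR n * t)) e PI.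

Lemma is_derive_mult_cst (f : R -> R) x df k :
  is_derive f x df -> is_derive (fun u => f u * k) x (df * k).
Proof.
  intros H. evar_last.
  - apply is_derive_mult_R; [exact H|apply is_derive_const].
  - unfold zero; simpl. ring.
Qed.

Lemma is_derive_kernel_int M n c e z : 1 < c -> 0 <= e <= PI -> 1 <= z -> (z < c \/ 0 < e) ->
  is_derive (kernel_int M n c e) z (kernel_int1 M n c e z).
Proof.
  intros Hc He Hz Hor.
  assert (Hloc := ker_ok_locally c e z Hc (proj1 He) Hz Hor).
  assert (Hok := locally_singleton _ _ Hloc).
  apply (is_derive_RInt_param_explicit (fun z t => ker M c z t * cos (IZR n * t))
    (fun z t => ker_z M c z t * cos (IZR n * t))); [easy|..].
  - revert Hloc; apply filter_imp. intros u Hu t Ht.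
    apply continuity_2d_pt_mult; [apply continuity_2d_ker, Hu, Ht|apply continuity_2d_pt_cos].
  - revert Hloc; apply filter_imp. intros u Hu t Ht.
    apply is_derive_mult_cst, is_derive_ker_z, Hu, Ht.
  - intros t Ht. apply locally_2d_impl with (2 := ker_dom_open c z t (Hok t Ht)).
    apply locally_2d_forall. intros u v Huv. now apply is_derive_mult_cst, is_derive_ker_z.
  - intros t Ht.
    apply continuity_2d_pt_mult; [apply continuity_2d_ker_z, Hok, Ht|apply continuity_2d_pt_cos].
Qed.

Lemma is_derive_kernel_int1 M n c e z : 1 < c -> 0 <= e <= PI -> 1 <= z -> (z < c \/ 0 < e) ->
  is_derive (kernel_int1 M n c e) z (kernel_int2 M n c e z).
Proof.
  intros Hc He Hz Hor.
  assert (Hloc := ker_ok_locally c e z Hc (proj1 He) Hz Hor).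
  assert (Hok := locally_singleton _ _ Hloc).
  apply (is_derive_RInt_param_explicit (fun z t => ker_z M c z t * cos (IZR n * t))
    (fun z t => ker_zz M c z t * cos (IZR n * t))); [easy|..].
  - revert Hloc; apply filter_imp. intros u Hu t Ht.
    apply continuity_2d_pt_mult; [apply continuity_2d_ker_z, Hu, Ht|apply continuity_2d_pt_cos].
  - revert Hloc; apply filter_imp. intros u Hu t Ht.
    apply is_derive_mult_cst, is_derive_ker_zz, Hu, Ht.
  - intros t Ht. apply locally_2d_impl with (2 := ker_dom_open c z t (Hok t Ht)).
    apply locally_2d_forall. intros u v Huv. now apply is_derive_mult_cst, is_derive_ker_zz.
  - intros t Ht.
    apply continuity_2d_pt_mult; [apply continuity_2d_ker_zz, Hok, Ht|apply continuity_2d_pt_cos].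
Qed.

Lemma continuous_cos_mult (f : R -> R -> R) n x y : continuity_2d_pt f x y ->
  continuous (fun t => f x t * cos (IZR n * t)) y.
Proof.
  intros H. apply (continuity_2d_pt_snd (fun u t => f u t * cos (IZR n * t))).
  apply continuity_2d_pt_mult; [exact H|apply continuity_2d_pt_cos].
Qed.

Lemma ex_RInt_cos_mult (f : R -> R -> R) n c e z : e <= PI -> ker_ok c e z ->
  (forall t, ker_dom c z t -> continuity_2d_pt f z t) ->
  ex_RInt (fun t => f z t * cos (IZR n * t)) e PI.
Proof.
  intros He Hok Hf. apply (ex_RInt_continuous (fun t => f z t * cos (IZR n * t))).
  rewrite Rmin_left, Rmax_right by easy.
  intros t Ht. now apply continuous_cos_mult, Hf, Hok.
Qed.

Lemma RInt_ker_tt M n c z : 1 < c -> 1 <= z < c ->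
  is_RInt (fun t => ker_tt M c z t * cos (IZR n * t)) 0 PI (- IZR n ^ 2 * kernel_int M n c 0 z).
Proof.
  intros Hc Hz.
  assert (Hpi := PI_RGT_0).
  assert (Hok : ker_ok c 0 z) by (apply ker_ok_here; lra).
  assert (H1 : is_RInt (fun t => ker_tt M c z t * cos (IZR n * t)
      + IZR n ^ 2 * (ker M c z t * cos (IZR n * t))) 0 PI 0).
  { evar_last.
    (* Two integrations by parts in one antiderivative. It vanishes at 0 and PI because every term
       of [ker_t] contains sin t and because sin(n PI) = 0. *)
    - apply (is_RInt_derive (fun t => ker_t M c z t * cos (IZR n * t)
        + IZR n * (ker M c z t * sin (IZR n * t)))); rewrite Rmin_left, Rmax_right by lra.
      + intros t Ht. specialize (Hok t Ht). evar_last.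
        * apply (is_derive_plus (fun t => ker_t M c z t * cos (IZR n * t))
            (fun t => IZR n * (ker M c z t * sin (IZR n * t)))).
          -- apply is_derive_mult_R; [now apply is_derive_ker_tt|].
             instantiate (1 := - (IZR n * sin (IZR n * t))). auto_derive; [auto|ring].
          -- apply (is_derive_scal (fun t => ker M c z t * sin (IZR n * t))).
             apply is_derive_mult_R; [now apply is_derive_ker_t|].
             instantiate (1 := IZR n * cos (IZR n * t)). auto_derive; [auto|ring].
        * unfold plus; simpl. ring.
      + intros t Ht. specialize (Hok t Ht).
        apply (continuous_plus (fun t => ker_tt M c z t * cos (IZR n * t))
          (fun t => IZR n ^ 2 * (ker M c z t * cos (IZR n * t)))).
        * now apply (continuous_cos_mult (ker_tt M c)), continuity_2d_ker_tt.
        * apply (continuous_scal_r (IZR n ^ 2) (fun t => ker M c z t * cos (IZR n * t))).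
          now apply (continuous_cos_mult (ker M c)), continuity_2d_ker.
    - unfold minus, plus, opp; simpl. unfold ker_t, kerR_t.
      rewrite sin_IZR_PI, sin_PI, (Rmult_0_r (IZR n)), sin_0. unfold Rdiv. ring. }
  assert (H2 : is_RInt (fun t => scal (IZR n ^ 2) (ker M c z t * cos (IZR n * t))) 0 PI
      (scal (IZR n ^ 2) (kernel_int M n c 0 z))).
  { apply (is_RInt_scal (fun t => ker M c z t * cos (IZR n * t))).
    apply (RInt_correct (fun t => ker M c z t * cos (IZR n * t))).
    apply (ex_RInt_cos_mult (ker M c) n c); [lra|easy|]. intros; now apply continuity_2d_ker. }
  evar_last.
  - eapply is_RInt_ext; [|exact (is_RInt_minus _ _ _ _ _ _ H1 H2)].
    intros t _. unfold minus, plus, opp, scal; simpl; unfold mult; simpl. ring.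
  - unfold minus, plus, opp, scal; simpl; unfold mult; simpl. ring.
Qed.

Lemma kernel_int_ode M n c z : 1 < c -> 1 <= z < c ->
  (z ^ 2 - 1) * kernel_int2 M n c 0 z + (2 * INR M + 2) * z * kernel_int1 M n c 0 z
    + ((INR M + 1 / 2) ^ 2 - INR (Z.abs_nat n) ^ 2) * kernel_int M n c 0 z = 0.
Proof.
  intros Hc Hz. assert (Hpi := PI_RGT_0).
  assert (Hok : ker_ok c 0 z) by (apply ker_ok_here; lra).
  assert (I0 : is_RInt (fun t => ker M c z t * cos (IZR n * t)) 0 PI (kernel_int M n c 0 z)).
  { apply (RInt_correct (fun t => ker M c z t * cos (IZR n * t))).
    apply (ex_RInt_cos_mult (ker M c) n c); [lra|easy|]. intros; now apply continuity_2d_ker. }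
  assert (I1 : is_RInt (fun t => ker_z M c z t * cos (IZR n * t)) 0 PI (kernel_int1 M n c 0 z)).
  { apply (RInt_correct (fun t => ker_z M c z t * cos (IZR n * t))).
    apply (ex_RInt_cos_mult (ker_z M c) n c); [lra|easy|]. intros; now apply continuity_2d_ker_z. }
  assert (I2 : is_RInt (fun t => ker_zz M c z t * cos (IZR n * t)) 0 PI (kernel_int2 M n c 0 z)).
  { apply (RInt_correct (fun t => ker_zz M c z t * cos (IZR n * t))).
    apply (ex_RInt_cos_mult (ker_zz M c) n c); [lra|easy|]. intros; now apply continuity_2d_ker_zz. }
  assert (I3 := RInt_ker_tt M n c z Hc Hz).
  assert (HL := is_RInt_plus _ _ _ _ _ _
    (is_RInt_plus _ _ _ _ _ _
      (is_RInt_scal _ _ _ (z ^ 2 - 1) _ I2)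
      (is_RInt_scal _ _ _ ((2 * INR M + 2) * z) _ I1))
    (is_RInt_plus _ _ _ _ _ _
      (is_RInt_scal _ _ _ (ker_al M ^ 2) _ I0) I3)).
  eapply is_RInt_ext with (g := fun _ => 0) in HL.
  - apply (is_RInt_unique (V := R_CompleteNormedModule)) in HL. rewrite RInt_const in HL.
    unfold plus, scal in HL; simpl in HL; unfold mult in HL; simpl in HL.
    assert (Hn : INR (Z.abs_nat n) ^ 2 = IZR n ^ 2).
    { rewrite <- (pow2_abs (IZR n)), <- abs_IZR, INR_IZR_INZ. do 2 f_equal. lia. }
    rewrite Hn. unfold ker_al in HL. lra.
  - rewrite Rmin_left, Rmax_right by lra. intros t Ht.
    pose proof (ker_pde M c z t (Hok t ltac:(lra))) as HW.
    unfold plus, scal; simpl; unfold mult; simpl.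
    transitivity (cos (IZR n * t) * ((z ^ 2 - 1) * ker_zz M c z t
      + (2 * INR M + 2) * z * ker_z M c z t
      + ker_al M ^ 2 * ker M c z t + ker_tt M c z t)); [ring|rewrite HW; ring].
Qed.

Definition heine (M : nat) (n : Z) (c : R) : R :=
  RInt (fun t => Rpower (c - cos t) (- ker_al M) * cos (IZR n * t)) 0 PI.

(** At z = 1 the hypergeometric argument vanishes for every [t], so only the power of [c - cos t]
    remains. *)
Lemma kernel_int_1 M n c : 1 < c -> kernel_int M n c 0 1 = / INR (fact M) * heine M n c.
Proof.
  intros Hc. unfold kernel_int, heine.
  rewrite <- (RInt_scal (fun t => Rpower (c - cos t) (- ker_al M) * cos (IZR n * t))).
  - apply RInt_ext. intros t _. unfold scal; simpl; unfold mult; simpl.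
    unfold ker, kerR, kerD, ker_hs.
    replace ((c ^ 2 - 1) * (1 ^ 2 - 1) / (c * 1 - cos t) ^ 2) with 0 by (unfold Rdiv; ring).
    rewrite hs_0. replace (c * 1 - cos t) with (c - cos t) by ring. ring.
  - eexists. apply (heine_integral (ker_al M) n c Hc).
Qed.

Lemma kernel_int_eq M n c z : 1 < c -> 1 <= z < c ->
  kernel_int M n c 0 z = heine M n c * geg_pfaff (INR (Z.abs_nat n)) M z.
Proof.
  intros Hc Hz. assert (Hpi := PI_RGT_0).
  rewrite (geg_regular_solution (INR (Z.abs_nat n)) M (kernel_int M n c 0)
    (kernel_int1 M n c 0) (kernel_int2 M n c 0) z); [|easy|apply pos_INR|..].
  - rewrite kernel_int_1 by easy. field. apply INR_fact_neq_0.
  - intros u Hu; apply is_derive_kernel_int; lra.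
  - intros u Hu; apply is_derive_kernel_int1; lra.
  - intros u Hu; apply kernel_int_ode; lra.
Qed.

(** * A bound for the kernel near the diagonal *)

(* The parameters of [ker_hs] satisfy [a + b = c], so the series has a logarithmic
   singularity at [1]; any negative power dominates it. *)
Lemma ker_hcoef_bound M : exists B, 0 < B /\ forall k,
  hcoef ((ker_al M + 1) / 2) (ker_al M / 2) M k <= B * hcoef (1 / 4) 1 0 k.
Proof.
  set (a := (ker_al M + 1) / 2). set (b := ker_al M / 2).
  assert (Hv : forall k, 0 < hcoef (1 / 4) 1 0 k).
  { intros k. rewrite hcoef_binomial. apply Rdiv_lt_0_compat; [apply poch_pos; lra|].
    apply INR_fact_lt_0. }
  (* Here a + b = M + 1, so the ratio decreases as soon as 4 a b <= k + M + 1, that is k >= M^2 + M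
     - 1/4. *)
  destruct (eventually_decr_bounded (fun k => hcoef a b M k / hcoef (1 / 4) 1 0 k) (M * M + M))
    as [B HB].
  - intros k Hk. pose proof (hcoef_succ a b M k) as H1. pose proof (hcoef_succ (1 / 4) 1 0 k) as H2.
    assert (Hpos : 0 < hcoef a b M k).
    { pose proof (pos_INR M). unfold hcoef. apply Rdiv_lt_0_compat.
      - apply Rmult_lt_0_compat; apply poch_pos; unfold a, b, ker_al; lra.
      - apply Rmult_lt_0_compat; apply INR_fact_lt_0. }
    pose proof (Hv k) as Hvk. pose proof (Hv (S k)) as Hvk'.
    set (u := hcoef a b M k) in *. set (u' := hcoef a b M (S k)) in *.
    set (v := hcoef (1 / 4) 1 0 k) in *. set (v' := hcoef (1 / 4) 1 0 (S k)) in *.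
    apply le_INR in Hk. rewrite plus_INR, mult_INR in Hk.
    pose proof (pos_INR M). pose proof (pos_INR k).
    set (x := INR k) in *. set (m := INR M) in *. simpl (INR 0) in H2.
    assert (Hu' : u' = (a + x) * (b + x) * u / ((x + 1) * (m + 1 + x)))
      by (rewrite <- H1; field; lra).
    assert (Hv' : v' = (1 / 4 + x) * v / (x + 1)).
    { apply Rmult_eq_reg_l with ((x + 1) * (0 + 1 + x)); [|nra].
      rewrite H2. field. lra. }
    assert (Hkey : (a + x) * (b + x) <= (1 / 4 + x) * (m + 1 + x))
      by (unfold a, b, ker_al; fold m; nra).
    replace (u' / v') with (u / v * ((a + x) * (b + x) / ((1 / 4 + x) * (m + 1 + x))))
      by (rewrite Hu', Hv'; field; lra).
    rewrite <- (Rmult_1_r (u / v)) at 2. apply Rmult_le_compat_l.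
    + left; apply Rdiv_lt_0_compat; lra.
    + apply Rmult_le_reg_r with ((1 / 4 + x) * (m + 1 + x)); [nra|].
      unfold Rdiv. rewrite Rmult_assoc, Rinv_l; nra.
  - exists (Rmax B 1). split; [apply Rlt_le_trans with (2 := Rmax_r _ _); lra|].
    intros k. specialize (HB k). specialize (Hv k).
    replace (hcoef a b M k) with (hcoef a b M k / hcoef (1 / 4) 1 0 k * hcoef (1 / 4) 1 0 k)
      by (field; lra).
    apply Rmult_le_compat_r; [lra|]. apply Rle_trans with (1 := HB), Rmax_l.
Qed.

Lemma ker_hs_nonneg M x : 0 <= x < 1 -> 0 <= ker_hs M x.
Proof.
  intros Hx. pose proof (pos_INR M). left. apply hs_pos; unfold ker_al; lra.
Qed.

Lemma ker_hs_bound M : exists B, 0 < B /\ forall x, 0 <= x < 1 ->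
  ker_hs M x <= B * Rpower (1 - x) (- (1 / 4)).
Proof.
  destruct (ker_hcoef_bound M) as [B [HB0 HB]]. exists B; split; [easy|].
  intros x Hx. assert (Hxa : Rabs x < 1) by (rewrite Rabs_pos_eq; lra).
  rewrite <- binomial_series by easy.
  unfold ker_hs, hs, PSeries. rewrite <- Series_scal_l. apply Series_le.
  - intros k. assert (0 <= x ^ k) by now apply pow_le. split.
    + apply Rmult_le_pos; [|easy]. pose proof (pos_INR M). unfold hcoef.
      left; apply Rdiv_lt_0_compat.
      * apply Rmult_lt_0_compat; apply poch_pos; unfold ker_al; lra.
      * apply Rmult_lt_0_compat; apply INR_fact_lt_0.
    + rewrite <- Rmult_assoc. now apply Rmult_le_compat_r.
  - apply (ex_series_scal B (fun k => hcoef (1 / 4) 1 0 k * x ^ k)).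
    apply ex_pseries_R, CV_radius_inside, hcoef_radius, Hxa.
Qed.

Lemma one_minus_cos_bound t : 0 <= t <= 1 -> t ^ 2 / 4 <= 1 - cos t.
Proof.
  intros Ht.
  (* The cubic Taylor bound t/2 - t^3/48 is at least 3t/8 on (0,1], and 2 (3/8)^2 = 9/32 exceeds
     1/4. *)
  assert (Hs : 3 * t / 8 <= sin (t / 2) \/ t = 0).
  { destruct (Req_dec t 0) as [H0|H0]; [now right|left].
    destruct (pre_sin_bound (t / 2) 0) as [Hl _]; [lra|lra|].
    assert (Ha : sin_approx (t / 2) (2 * 0 + 1) = t / 2 - t ^ 3 / 48)
      by (unfold sin_approx, sin_term; simpl; field).
    rewrite Ha in Hl.
    assert (0 <= t * ((1 - t) * (1 + t))) by (repeat apply Rmult_le_pos; lra).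
    nra. }
  assert (Hc : cos t = 1 - 2 * sin (t / 2) * sin (t / 2)).
  { rewrite <- cos_2a_sin. f_equal. field. }
  rewrite Hc. destruct Hs as [Hs| ->].
  - assert ((3 * t / 8) * (3 * t / 8) <= sin (t / 2) * sin (t / 2))
      by (apply Rmult_le_compat; lra).
    pose proof (pow2_ge_0 t). lra.
  - replace (0 / 2) with 0 by field. rewrite sin_0. lra.
Qed.

Lemma Rpower_le_neg x y p : 0 < x <= y -> 0 <= p -> Rpower y (- p) <= Rpower x (- p).
Proof.
  intros Hxy Hp. rewrite !Rpower_Ropp. apply Rinv_le_contravar; [apply exp_pos|].
  apply Rle_Rpower_l; lra.
Qed.

(** Writing 1 - kerR = gap / D^2, the power -1/4 contributes D^(1/2), and with D^(-al) only D^(-M)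
    is left, bounded through D >= c - 1. The angular term of the gap gives gap >= (c-1)/2 t^2; the
    exponent 1/4 turns t^2 into the integrable t^(-1/2), uniformly in z. *)
Lemma ker_bound M c : 1 < c -> exists K, 0 < K /\ forall z t,
  1 <= z < c -> 0 < t <= 1 -> Rabs (ker M c z t) <= K / sqrt t.
Proof.
  intros Hc. destruct (ker_hs_bound M) as [B [HB0 HB]].
  set (ka := (c - 1) / 2).
  exists (B * / (c - 1) ^ M * Rpower ka (- (1 / 4))). split.
  { repeat apply Rmult_lt_0_compat; [easy|apply Rinv_0_lt_compat, pow_lt; lra|apply exp_pos]. }
  intros z t Hz Ht.
  pose proof (COS_bound t) as Hcos.
  assert (Hdom : ker_dom c z t) by (apply ker_dom_ge_1; lra).
  destruct Hdom as [HD HR].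
  assert (Hcz : c - 1 <= c * z - 1) by nra.
  assert (HD1 : c - 1 <= kerD c z t) by (unfold kerD; lra).
  assert (HD2 : 0 < kerD c z t ^ 2) by now apply pow_lt.
  assert (HR0 : 0 <= kerR c z t).
  { apply Rdiv_le_0_compat; [|easy]. apply Rmult_le_pos; nra. }
  apply Rabs_def2 in HR.
  assert (Hgap0 : 0 < ker_gap c z t) by (apply ker_gap_pos; lra).
  assert (Hgap : ka * t ^ 2 <= ker_gap c z t).
  { pose proof (one_minus_cos_bound t ltac:(lra)). rewrite ker_gap_eq.
    pose proof (pow2_ge_0 (c - z)).
    assert (t ^ 2 / 4 * (2 * (c - 1)) <= (1 - cos t) * (2 * (c * z) - 1 - cos t)).
    { apply Rmult_le_compat; try lra. apply Rmult_le_pos; [apply pow2_ge_0|lra]. }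
    unfold ka. lra. }
  assert (Hka : 0 < ka * t ^ 2) by (apply Rmult_lt_0_compat; [unfold ka; lra|apply pow_lt; lra]).
  unfold ker. rewrite Rabs_pos_eq
    by (apply Rmult_le_pos; [left; apply exp_pos|apply ker_hs_nonneg; lra]).
  apply Rle_trans with (Rpower (kerD c z t) (- ker_al M) *
    (B * Rpower (1 - kerR c z t) (- (1 / 4)))).
  { apply Rmult_le_compat_l; [left; apply exp_pos|apply HB; lra]. }
  rewrite one_minus_kerR by easy.
  change (ker_gap c z t / kerD c z t ^ 2) with (ker_gap c z t * / kerD c z t ^ 2).
  rewrite <- Rpower_mult_distr by (try apply Rinv_0_lt_compat; assumption).
  assert (HDp : Rpower (/ kerD c z t ^ 2) (- (1 / 4)) = Rpower (kerD c z t) (1 / 2)).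
  { rewrite <- (Rpower_pow 2 (kerD c z t)) by easy. rewrite <- Rpower_Ropp, Rpower_mult.
    f_equal. simpl. field. }
  rewrite HDp.
  replace (Rpower (kerD c z t) (- ker_al M) *
    (B * (Rpower (ker_gap c z t) (- (1 / 4)) * Rpower (kerD c z t) (1 / 2))))
    with (B * (Rpower (kerD c z t) (- ker_al M) * Rpower (kerD c z t) (1 / 2))
      * Rpower (ker_gap c z t) (- (1 / 4))) by ring.
  rewrite <- Rpower_plus.
  replace (- ker_al M + 1 / 2) with (- INR M) by (unfold ker_al; field).
  rewrite (Rpower_Ropp _ (INR M)), Rpower_pow by easy.
  assert (Hsq : Rpower (t ^ 2) (- (1 / 4)) = / sqrt t).
  { rewrite <- (Rpower_pow 2 t) by lra. rewrite Rpower_mult, <- Rpower_sqrt by lra.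
    rewrite <- Rpower_Ropp. f_equal. simpl. field. }
  match goal with |- _ <= ?K / sqrt t => change (K / sqrt t) with (K * / sqrt t) end.
  rewrite <- Hsq.
  rewrite (Rmult_assoc (B * / (c - 1) ^ M)), Rpower_mult_distr by (unfold ka in *; try apply pow_lt; lra).
  apply Rmult_le_compat.
  - apply Rmult_le_pos; [lra|]. left; apply Rinv_0_lt_compat, pow_lt; lra.
  - left; apply exp_pos.
  - apply Rmult_le_compat_l; [lra|]. apply Rinv_le_contravar; [apply pow_lt; lra|].
    apply pow_incr; lra.
  - apply Rpower_le_neg; lra.
Qed.

(** The antiderivative [2 K sqrt x] of the majorant is continuous at 0, so the mean value theorem on
    [0, e] replaces a comparison of improper integrals. *)
Lemma RInt_inv_sqrt_bound (f : R -> R) (K e : R) : 0 < e ->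
  (forall t, continuous f t) ->
  (forall t, 0 < t <= e -> Rabs (f t) <= K / sqrt t) ->
  Rabs (RInt f 0 e) <= 2 * K * sqrt e.
Proof.
  intros He Hf HK.
  assert (Haux : forall g : R -> R, (forall t, continuous g t) ->
    (forall t, 0 < t <= e -> g t <= K / sqrt t) -> RInt g 0 e <= 2 * K * sqrt e).
  { intros g Hg HgK.
    assert (HdG : forall x, is_derive (fun x => RInt g 0 x) x (g x)).
    { intros x. apply (is_derive_RInt g (fun x => RInt g 0 x) 0 x); [|apply Hg].
      apply filter_forall; intros y. apply (RInt_correct g), (ex_RInt_continuous g).
      intros u _; apply Hg. }
    (* [MVT_gen] may return the endpoint [0], where [K / sqrt x] is a junk value. *)
    destruct (MVT_gen (fun x => 2 * K * sqrt x - RInt g 0 x) 0 e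
      (fun x => if Rle_dec x 0 then 0 else K / sqrt x - g x)) as [x [Hx Heq]].
    - rewrite Rmin_left, Rmax_right by lra. intros x Hx.
      destruct (Rle_dec x 0); [lra|].
      apply (is_derive_minus (fun x => 2 * K * sqrt x) (fun x => RInt g 0 x)); [|apply HdG].
      auto_derive; [lra|]. field. apply Rgt_not_eq, sqrt_lt_R0; lra.
    - rewrite Rmin_left, Rmax_right by lra. intros x Hx.
      apply continuity_pt_filterlim.
      apply (continuous_minus (fun x => 2 * K * sqrt x) (fun x => RInt g 0 x)).
      + apply (continuous_scal_r (2 * K) sqrt), continuous_sqrt.
      + apply (ex_derive_continuous (fun x => RInt g 0 x)). eexists; apply HdG.
    - rewrite Rmin_left, Rmax_right in Hx by lra.
      assert (H0 : RInt g 0 0 = 0) by exact (RInt_point 0 g).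
      rewrite sqrt_0, H0 in Heq.
      assert (0 <= if Rle_dec x 0 then 0 else K / sqrt x - g x).
      { destruct (Rle_dec x 0); [lra|]. specialize (HgK x ltac:(lra)). lra. }
      set (d := if Rle_dec x 0 then 0 else _) in *. nra. }
  apply Rabs_le. split.
  - assert (H : RInt (fun t => - f t) 0 e <= 2 * K * sqrt e).
    { apply Haux.
      - intros t. apply (continuous_opp f), Hf.
      - intros t Ht. specialize (HK t Ht). pose proof (Rle_abs (- f t)).
        rewrite Rabs_Ropp in *. lra. }
    assert (Ho : RInt (fun t => - f t) 0 e = - RInt f 0 e).
    { apply (RInt_opp f), (ex_RInt_continuous f). intros u _; apply Hf. }
    lra.
  - apply Haux; [exact Hf|]. intros t Ht. specialize (HK t Ht).
    pose proof (Rle_abs (f t)). lra.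
Qed.

Lemma continuous_le_left (F : R -> R) (a c B : R) : a < c -> continuous F c ->
  (forall z, a <= z < c -> F z <= B) -> F c <= B.
Proof.
  intros Hac HF Hle. destruct (Rle_lt_dec (F c) B) as [H|H]; [easy|exfalso].
  assert (Heps : 0 < F c - B) by lra.
  destruct (proj1 (filterlim_locally F (F c)) HF (mkposreal _ Heps)) as [d Hd].
  set (z := Rmax a (c - d / 2)). pose proof (cond_pos d).
  assert (Hz : a <= z < c) by (split; [apply Rmax_l|apply Rmax_lub_lt; lra]).
  assert (Hb : ball c d z).
  { change (Rabs (z - c) < d). rewrite Rabs_left by lra.
    pose proof (Rmax_r a (c - d / 2)). fold z in H1. lra. }
  specialize (Hd z Hb). change (Rabs (F z - F c) < F c - B) in Hd.
  apply Rabs_def2 in Hd. specialize (Hle z Hz). lra.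
Qed.

(** The order of limits is the point. For fixed [e > 0] the truncated integral is continuous up to z
    = c, and [K] does not depend on z, so the estimate passes to z = c before [e] tends to 0. *)
Lemma kernel_int_tail_bound M n c : 1 < c -> exists K, 0 < K /\ forall z e,
  1 <= z <= c -> 0 < e <= 1 ->
  Rabs (kernel_int M n c e z - heine M n c * geg_pfaff (INR (Z.abs_nat n)) M z) <= K * sqrt e.
Proof.
  intros Hc. assert (Hpi : 1 < PI) by (pose proof PI2_1; lra).
  destruct (ker_bound M c Hc) as [K [HK0 HK]].
  exists (2 * K). split; [lra|].
  assert (Hlt : forall z e, 1 <= z < c -> 0 < e <= 1 ->
    Rabs (kernel_int M n c e z - heine M n c * geg_pfaff (INR (Z.abs_nat n)) M z) <= 2 * K * sqrt e).
  { intros z e Hz He. rewrite <- kernel_int_eq by easy.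
    set (f := fun t => ker M c z t * cos (IZR n * t)).
    assert (Hf : forall t, continuous f t).
    { intros t. apply (continuous_cos_mult (ker M c)), continuity_2d_ker.
      apply ker_dom_ge_1; lra. }
    assert (Hex : forall a b, ex_RInt f a b).
    { intros a b. apply (ex_RInt_continuous f). intros t _; apply Hf. }
    change (Rabs (RInt f e PI - RInt f 0 PI) <= 2 * K * sqrt e).
    rewrite <- (RInt_Chasles f 0 e PI) by apply Hex.
    unfold plus; simpl.
    replace (RInt f e PI - (RInt f 0 e + RInt f e PI)) with (- RInt f 0 e) by ring.
    rewrite Rabs_Ropp. apply RInt_inv_sqrt_bound; [lra|exact Hf|].
    intros t Ht. unfold f. rewrite Rabs_mult. specialize (HK z t Hz ltac:(lra)).
    assert (Rabs (cos (IZR n * t)) <= 1) by (apply Rabs_le, COS_bound).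
    pose proof (Rabs_pos (cos (IZR n * t))). pose proof (Rabs_pos (ker M c z t)). nra. }
  intros z e [Hz1 [Hz2|Hz2]] He; [apply Hlt; lra|]. subst z.
  apply (continuous_le_left (fun z =>
    Rabs (kernel_int M n c e z - heine M n c * geg_pfaff (INR (Z.abs_nat n)) M z)) 1 c); [easy| |].
  - apply (continuous_comp (fun z => kernel_int M n c e z
      - heine M n c * geg_pfaff (INR (Z.abs_nat n)) M z) Rabs); [|apply continuous_Rabs].
    apply (continuous_minus (kernel_int M n c e)).
    + apply (ex_derive_continuous (kernel_int M n c e)). eexists. apply is_derive_kernel_int; lra.
    + apply (continuous_scal_r (heine M n c) (geg_pfaff (INR (Z.abs_nat n)) M)).
      apply (ex_derive_continuous (geg_pfaff (INR (Z.abs_nat n)) M)). eexists.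
      apply is_derive_geg_pfaff; lra.
  - intros z Hz. now apply Hlt.
Qed.

Lemma is_RInt_gen_ker M n c z : 1 < c -> 1 <= z <= c ->
  is_RInt_gen (fun t => ker M c z t * cos (IZR n * t)) (at_right 0) (at_point PI)
    (heine M n c * geg_pfaff (INR (Z.abs_nat n)) M z).
Proof.
  intros Hc Hz. assert (Hpi : 1 < PI) by (pose proof PI2_1; lra).
  destruct (kernel_int_tail_bound M n c Hc) as [K [HK0 HK]].
  intros P [eps HP].
  set (r := eps / (2 * K)). pose proof (cond_pos eps) as Heps.
  assert (Hr : 0 < r) by (apply Rdiv_lt_0_compat; lra).
  (* For [e < d] this gives [K * sqrt e <= eps / 2]; the minimum with 1 keeps [e] in the range of
     the tail bound. *)
  set (d := Rmin 1 (r ^ 2)).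
  assert (Hd : 0 < d) by (apply Rmin_glb_lt; [lra|now apply pow_lt]).
  apply (Filter_prod _ _ _ (fun x => 0 < x < d) (fun y => y = PI)).
  - exists (mkposreal d Hd). intros y Hy Hy0. change (Rabs (y - 0) < d) in Hy.
    apply Rabs_def2 in Hy. lra.
  - reflexivity.
  - intros e y He ->. simpl.
    assert (He1 : 0 < e <= 1) by (pose proof (Rmin_l 1 (r ^ 2)); fold d in H; lra).
    exists (kernel_int M n c e z). split.
    + apply (RInt_correct (fun t => ker M c z t * cos (IZR n * t))).
      apply (ex_RInt_cos_mult (ker M c) n c); [lra| |intros; now apply continuity_2d_ker].
      apply ker_ok_here; lra.
    + apply HP. change (Rabs (kernel_int M n c e z
        - heine M n c * geg_pfaff (INR (Z.abs_nat n)) M z) < eps).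
      eapply Rle_lt_trans; [apply HK; easy|].
      assert (Hs : sqrt e <= r).
      { rewrite <- (sqrt_pow2 r) by lra. apply sqrt_le_1; [lra|apply pow2_ge_0|].
        pose proof (Rmin_r 1 (r ^ 2)). fold d in H. lra. }
      apply Rle_lt_trans with (K * r); [apply Rmult_le_compat_l; lra|].
      unfold r. replace (K * (eps / (2 * K))) with (eps / 2) by (field; lra). lra.
Qed.

(** * Hyperbolic parametrization and assembly *)

Lemma cosh_sinh_sqr s : sinh s ^ 2 = cosh s ^ 2 - 1.
Proof.
  unfold sinh, cosh. rewrite exp_Ropp. pose proof (exp_pos s). field. lra.
Qed.

Lemma sinh_pos s : 0 < s -> 0 < sinh s.
Proof.
  intros Hs. unfold sinh. assert (exp (- s) < exp s) by (apply exp_increasing; lra). lra.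
Qed.

Lemma cosh_gt_1 s : 0 < s -> 1 < cosh s.
Proof.
  intros Hs. pose proof (cosh_sinh_sqr s). pose proof (sinh_pos s Hs).
  assert (0 < cosh s) by (unfold cosh; pose proof (exp_pos s); pose proof (exp_pos (- s)); lra).
  nra.
Qed.

Lemma cosh_le s s' : 0 < s -> s <= s' -> cosh s <= cosh s'.
Proof.
  intros Hs Hss. pose proof (cosh_gt_1 s Hs). pose proof (cosh_gt_1 s' ltac:(lra)).
  pose proof (cosh_sinh_sqr s). pose proof (cosh_sinh_sqr s').
  pose proof (sinh_pos s Hs).
  assert (sinh s <= sinh s').
  { unfold sinh. destruct Hss as [H4|H4]; [|subst; lra].
    assert (exp s < exp s') by now apply exp_increasing.
    assert (exp (- s') < exp (- s)) by (apply exp_increasing; lra). lra. }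
  nra.
Qed.

(** Positivity of the gap says exactly D > S S', so the argument of Q exceeds 1. At order 0, Q is a
    power of this argument times a series in [kerR], and (S S')^al splits off. *)
Lemma LegendreQ_ker m z S c S' t :
  1 < z -> 0 < S -> S ^ 2 = z ^ 2 - 1 -> 1 < c -> 0 < S' -> S' ^ 2 = c ^ 2 - 1 ->
  cos t < 1 ->
  let M := Z.abs_nat m in
  LegendreQ 0 (IZR m - 1 / 2) (kerD c z t / (S * S')) =
  sqrt PI * Gamma (ker_al M) * Rpower (S * S') (ker_al M) / Rpower 2 (ker_al M) * ker M c z t.
Proof.
  intros Hz HS HS2 Hc HS' HS2' Ht M.
  assert (Hdom : ker_dom c z t) by (apply ker_dom_ge_1; lra).
  destruct Hdom as [HD HR].
  assert (HSS : 0 < S * S') by now apply Rmult_lt_0_compat.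
  assert (Hgap : 0 < ker_gap c z t) by (apply ker_gap_pos; [nra|lra]).
  set (x := kerD c z t / (S * S')).
  assert (Hx0 : 0 < x) by now apply Rdiv_lt_0_compat.
  assert (Hx : 1 < x).
  { apply Rmult_lt_reg_r with (S * S'); [easy|]. unfold x, Rdiv.
    rewrite Rmult_assoc, Rinv_l by lra.
    unfold ker_gap in Hgap. rewrite <- HS2, <- HS2' in Hgap. nra. }
  assert (Hx2 : 0 < x ^ 2 - 1) by nra.
  (* [legQ] takes a positive root of [x^2 - 1]; at order 0 it enters as a zeroth power and
     disappears on simplification. *)
  rewrite (LegendreQ_half 0 m x (sqrt (x ^ 2 - 1)));
    [|easy|now apply sqrt_lt_R0|apply pow2_sqrt; lra].
  fold M. unfold legQ. rewrite Z.add_0_l, <- INR_IZR_INZ. simpl powerRZ.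
  rewrite !Rplus_0_r. fold (ker_al M).
  unfold ker, ker_hs.
  replace (INR M / 2 + 3 / 4) with ((ker_al M + 1) / 2) by (unfold ker_al; field).
  replace (INR M / 2 + 1 / 4) with (ker_al M / 2) by (unfold ker_al; field).
  replace (1 / x ^ 2) with (kerR c z t)
    by (unfold kerR, x; rewrite <- HS2, <- HS2'; field; lra).
  replace (Rpower (kerD c z t) (- ker_al M))
    with (/ (Rpower x (ker_al M) * Rpower (S * S') (ker_al M))).
  - field. repeat split; apply Rgt_not_eq, exp_pos.
  - rewrite Rpower_mult_distr by easy. rewrite Rpower_Ropp. do 2 f_equal.
    unfold x. field. lra.
Qed.

Lemma powerRZ_m1_abs m : powerRZ (-1) m = (-1) ^ Z.abs_nat m.
Proof.
  destruct (Z_le_dec 0 m) as [H|H].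
  - rewrite pow_powerRZ. f_equal. lia.
  - replace m with (- Z.of_nat (Z.abs_nat m))%Z at 1 by lia.
    rewrite powerRZ_opp_nat, <- pow_inv. f_equal. field.
Qed.

Lemma LegendreQ_cos_integral_le (m n : Z) (s s' : R) : 0 < s -> s <= s' ->
  is_RInt_gen
    (fun psi => LegendreQ 0 (IZR m - 1 / 2)
                  (coth s * coth s' - csch s * csch s' * cos psi) * cos (IZR n * psi))
    (at_right 0) (at_point PI)
    (PI * powerRZ (-1) m * sqrt (sinh s * sinh s')
     * (Gamma (IZR n - IZR m + 1 / 2) / Gamma (IZR n + IZR m + 1 / 2))
     * LegendreP m (IZR n - 1 / 2) (cosh s)
     * LegendreQ m (IZR n - 1 / 2) (cosh s')).
Proof.
  intros Hs Hss. assert (Hs' : 0 < s') by lra.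
  assert (Hpi : 1 < PI) by (pose proof PI2_1; lra).
  pose proof (cosh_gt_1 s Hs) as Hz. pose proof (cosh_gt_1 s' Hs') as Hc.
  pose proof (sinh_pos s Hs) as HS. pose proof (sinh_pos s' Hs') as HS'.
  pose proof (cosh_sinh_sqr s) as HS2. pose proof (cosh_sinh_sqr s') as HS2'.
  pose proof (cosh_le s s' Hs Hss) as Hzc.
  set (M := Z.abs_nat m).
  set (A := sqrt PI * Gamma (ker_al M) * Rpower (sinh s * sinh s') (ker_al M)
    / Rpower 2 (ker_al M)).
  assert (H := is_RInt_gen_scal (Fa := at_right 0) (Fb := at_point PI) _ A _
    (is_RInt_gen_ker M n (cosh s') (cosh s) Hc ltac:(lra))).
  eapply is_RInt_gen_ext in H.
  - evar_last; [exact H|].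
    pose proof (Gamma_ratio_PQ m n _ _ _ _ Hz HS HS2 Hc HS' HS2') as HPQ.
    rewrite (legQ_heine _ n _ _ Hc) in HPQ. fold M in HPQ. fold (ker_al M) in HPQ.
    fold (heine M n (cosh s')) in HPQ.
    unfold scal; simpl; unfold mult; simpl.
    symmetry.
    etransitivity; [|etransitivity; [apply (f_equal (fun w => PI * powerRZ (-1) m
      * sqrt (sinh s * sinh s') * w)), HPQ|]]; [ring|].
    rewrite powerRZ_m1_abs. fold M. unfold A.
    (* One sign is the (-1)^m of the claim, the other is the e^(m pi i) in Q^m. *)
    assert (Hm : (-1) ^ M * (-1) ^ M = 1).
    { rewrite <- Rpow_mult_distr. replace (-1 * -1) with 1 by ring. apply pow1. }
    replace (Rpower 2 (ker_al M)) with (2 ^ M * Rpower 2 (1 / 2))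
      by (unfold ker_al; rewrite Rpower_plus, Rpower_pow by lra; easy).
    (* The half in al = M + 1/2 produces the square root of the claim; the M-th powers belong to P
       and Q. *)
    replace (Rpower (sinh s * sinh s') (ker_al M))
      with ((sinh s) ^ M * (sinh s') ^ M * sqrt (sinh s * sinh s')).
    + unfold Rdiv. rewrite Rpow_mult_distr, pow_inv.
      set (h := heine _ _ _). set (g := geg_pfaff _ _ _).
      transitivity (((-1) ^ M * (-1) ^ M) * (sqrt PI * Gamma (ker_al M) *
        (sinh s ^ M * sinh s' ^ M * sqrt (sinh s * sinh s')) /
        (2 ^ M * Rpower 2 (1 / 2)) * (h * g))); [|rewrite Hm; unfold Rdiv; ring].
      change (1 * / 2) with (1 / 2).
      field. repeat split; [apply Rgt_not_eq, exp_pos|apply pow_nonzero; lra|lra].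
    + assert (HSS : 0 < sinh s * sinh s') by now apply Rmult_lt_0_compat.
      unfold ker_al. rewrite Rpower_plus, Rpower_pow, Rpow_mult_distr by easy.
      replace (1 / 2) with (/ 2) by field. now rewrite Rpower_sqrt.
  (* The integrands are compared only at t > 0, where cos t < 1; every truncated interval [e, PI]
     lies there. *)
  - apply (Filter_prod _ _ _ (fun x => 0 < x < 1) (fun y => y = PI)).
    + exists (mkposreal 1 Rlt_0_1). intros y Hy Hy0. change (Rabs (y - 0) < 1) in Hy.
      apply Rabs_def2 in Hy. lra.
    + reflexivity.
    + intros e y He ->. simpl. rewrite Rmin_left, Rmax_right by lra. intros t Ht.
      assert (Hcos : cos t < 1) by (apply cos_lt_1; lra).
      replace (coth s * coth s' - csch s * csch s' * cos t)
        with (kerD (cosh s') (cosh s) t / (sinh s * sinh s'))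
        by (unfold coth, csch, kerD; field; lra).
      rewrite (LegendreQ_ker m _ _ _ _ t Hz HS HS2 Hc HS' HS2' Hcos).
      unfold scal; simpl; unfold mult; simpl. fold M. fold A. ring.
Qed.

Theorem theorem3p7 (m n : Z) (s s' : R) (hs : 0 < s) (hs' : 0 < s') :
  is_RInt_gen
    (fun psi => LegendreQ 0 (IZR m - 1 / 2)
                  (coth s * coth s' - csch s * csch s' * cos psi) * cos (IZR n * psi))
    (at_right 0) (at_point PI)
    (PI * powerRZ (-1) m * sqrt (sinh s * sinh s')
     * (Gamma (IZR n - IZR m + 1 / 2) / Gamma (IZR n + IZR m + 1 / 2))
     * LegendreP m (IZR n - 1 / 2) (cosh (Rmin s s'))
     * LegendreQ m (IZR n - 1 / 2) (cosh (Rmax s s'))).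
Proof.
  destruct (Rle_dec s s') as [H|H].
  - rewrite Rmin_left, Rmax_right by easy. now apply LegendreQ_cos_integral_le.
  - rewrite Rmin_right, Rmax_left by lra. rewrite (Rmult_comm (sinh s)).
    assert (Hs : s' <= s) by lra.
    generalize (LegendreQ_cos_integral_le m n s' s hs' Hs).
    apply is_RInt_gen_ext. apply filter_forall. intros ab x _.
    now rewrite (Rmult_comm (coth s)), (Rmult_comm (csch s)).
Qed.
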